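(* Let $M\cong\mathbb{Z}^2$ and let $P_0\subseteq M_{\mathbb{R}}$ be a half-integral polygon with $\dim\bar F(P_0)=2$. Then: (1) $\bar F(P_0)$ is a half-integral polygon, and every edge of $\bar F(P_0)$ contains lattice points. (2) $\bar F(P_0)$ is the union of $\mathrm{conv}(\mathrm{int}(P_0)\cap M)$ with some triangles, where the base of each of these triangles is an edge of $\mathrm{conv}(\mathrm{int}(P_0)\cap M)$ containing exactly two lattice points, and the third vertex of the triangle has lattice height at most $\tfrac12(|P_0\cap M|+2)$ over this edge. (3) Every vertex of $\mathrm{conv}(\mathrm{int}(P_0)\cap M)$ is a boundary lattice point of $\bar F(P_0)$.
   Context: $M\cong\mathbb{Z}^2$ is a lattice, $N=\mathrm{Hom}(M,\mathbb{Z})$, $M_{\mathbb{R}}=M\otimes\mathbb{R}$, $\langle\cdot,\cdot\rangle$ the natural pairing. Lattice points are points of $M$. A polygon (a $2$-dimensional polytope) in $M_{\mathbb{R}}$ is half-integral if all its vertices lie in $\tfrac12M$. $\mathrm{int}(P_0)$ denotes the topological interior. For a polytope $P_0\subseteq M_{\mathbb{R}}$ and $n\in N$ put $\mathrm{Min}_{P_0}(n)=\min\{\langle x,n\rangle\mid x\in P_0\}$. For half-integral $P_0$ put $N_1(P_0)=\{n\in N\setminus\{0\}\mid\mathrm{Min}_{P_0}(n)\in\mathbb{Z}\}$, $N_2(P_0)=\{n\in N\setminus\{0\}\mid\mathrm{Min}_{P_0}(n)\notin\mathbb{Z}\}$, and $$\bar F(P_0)=\{x\in M_{\mathbb{R}}\mid\langle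 x,n\rangle\ge\mathrm{Min}_{P_0}(n)+1\ \forall n\in N_1(P_0)\}\cap\{x\in M_{\mathbb{R}}\mid\langle x,2n\rangle\ge\mathrm{Min}_{P_0}(2n)+1\ \forall n\in N_2(P_0)\}.$$ An edge is a $1$-dimensional face; if $\mathrm{conv}(\mathrm{int}(P_0)\cap M)$ is a line segment, the segment itself counts as an edge (and triangles may lie on either side of it). The lattice height of a point $v$ over an edge $e$ is $|\langle v,n\rangle-c|$, where $n\in N$ is primitive and $e$ lies on the line $\{x\mid\langle x,n\rangle=c\}$. *)

(* Defs.v *)
From mathcomp Require Import all_boot all_order all_algebra.
From mathcomp Require Import finmap.
From mathcomp Require Import boolp classical_sets functions cardinality reals.
From mathcomp Require Import topology normedtype convex.
Import Order.TTheory GRing.Theory Num.Theory.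
Import numFieldNormedType.Exports.

Set Implicit Arguments.
Unset Strict Implicit.
Unset Printing Implicit Defensive.

Local Open Scope classical_set_scope.
Local Open Scope ring_scope.

(* After a choice of basis, M is the lattice of integral row vectors inside
   M_R = 'rV[R]_2, and N = Hom(M, Z) is the lattice of integral column vectors
   inside the dual space N_R = 'cV[R]_2. *)

Section LatticePolytopes.
Variable R : realType.
Implicit Types (A P F e : set 'rV[R]_2) (x v : 'rV[R]_2) (n : 'cV[int]_2).

Definition real_pairing x (u : 'cV[R]_2) : R := (x *m u) 0 0.

Definition pairing x n : R := real_pairing x (map_mx intr n).

Definition lattice : set 'rV[R]_2 :=
  range (fun z : 'rV[int]_2 => map_mx intr z).

Definition half_lattice : set 'rV[R]_2 := [set x | lattice (2 *: x)].

(* A junk value 0 is returned when A contains infinitely many lattice points. *)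
Definition num_lattice_points A : nat := #|` fset_set (A `&` lattice) |.

Definition conv_hull A : set 'rV[R]_2 := smallest (@convex_set R 'rV[R]_2) A.

Definition affinely_independent d (p : 'I_d.+1 -> 'rV[R]_2) : bool :=
  row_free (\matrix_(i < d) (p (lift ord0 i) - p ord0)).

Definition has_dim A (d : nat) : Prop :=
  (exists2 p : 'I_d.+1 -> 'rV[R]_2,
     (forall i, A (p i)) & affinely_independent p) /\
  (forall p : 'I_d.+2 -> 'rV[R]_2,
     (forall i, A (p i)) -> ~~ affinely_independent p).

Definition is_polytope P : Prop :=
  exists2 A, finite_set A & P = conv_hull A.

Definition is_polygon P : Prop := is_polytope P /\ has_dim P 2.

(* Taking u = 0, a polytope is a face of itself; so a segment is an edge of
   itself. *)
Definition is_face P F : Prop :=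
  exists u : 'cV[R]_2,
    F = [set x | P x /\ forall y, P y -> real_pairing x u <= real_pairing y u].

Definition is_vertex P v : Prop := is_face P [set v].

Definition is_edge P e : Prop := is_face P e /\ has_dim e 1.

Definition half_integral_polygon P : Prop :=
  is_polygon P /\ forall v, is_vertex P v -> half_lattice v.

Definition primitive n : bool := coprimez (n 0 0) (n 1 0).

(* The defining pair (n, c) is determined up to sign, so h is unique as soon as
   e is 1-dimensional. *)
Definition has_lattice_height v e (h : R) : Prop :=
  exists n (c : R), [/\ primitive n, forall x, e x -> pairing x n = c
                      & h = `|pairing v n - c|].

(* T is a nondegenerate triangle with base e (a segment) and third vertex v. *)
Definition is_triangle_over e v (T : set 'rV[R]_2) : Prop :=
  T = conv_hull (e `|` [set v]) /\ has_dim T 2.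

(* The least element of the set of values; it exists for a nonempty polytope,
   and the junk value 0 is returned when there is none. *)
Definition Min P n : R :=
  let values := (fun x => pairing x n) @` P in xget 0 (values `&` lbound values).

Definition N1 P : set 'cV[int]_2 :=
  [set n | n != 0 /\ Min P n \is a Num.int].

Definition N2 P : set 'cV[int]_2 :=
  [set n | n != 0 /\ Min P n \isn't a Num.int].

Definition Fbar P : set 'rV[R]_2 :=
  [set x | forall n, N1 P n -> pairing x n >= Min P n + 1] `&`
  [set x | forall n, N2 P n -> pairing x (n *+ 2) >= Min P (n *+ 2) + 1].

Definition interior_hull P : set 'rV[R]_2 := conv_hull (interior P `&` lattice).

Definition boundary A : set 'rV[R]_2 := closure A `\` interior A.

End LatticePolytopes.

(* Main.v *)
(* Since P0 is half-integral, Fbar P0 is the set of x with <x,n> >= k + 1 for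
   every nonzero n in N and every integer k <= Min n.  Let w be a non-lattice
   vertex of it, on an edge line <x,n> = k + 1.  Choose unimodular coordinates
   in which this line is y = 1 and w = (x0,1) with 0 < x0 < 1.  As (1,1) is not
   in Fbar P0, some integral functional is at least its value at (1,1) on the
   whole of P0; after a shear this forces (1/2,0) to be a vertex of P0 and
   x0 <= 1/2.  The second edge line at w must then be y - 2ex = 1 - e for an
   integer e > 0, and x0 = 1/2: so w = (1/2,1), the nearest lattice points on
   the two edges are (0,1) and (1,e+1), and cutting w off along the line through
   them loses no lattice point.  The height of w over it is e/2, while P0 meets
   each of the lines x = 0 and x = 1 in a segment of length at least e/2.
   Cutting off all corners leaves a polygon with lattice vertices, which is
   therefore the hull of the interior lattice points of P0. *)

Require Import Defs.
From mathcomp Require Import all_boot all_order all_algebra.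
From mathcomp Require Import finmap.
From mathcomp Require Import boolp classical_sets functions cardinality reals.
From mathcomp Require Import topology normedtype convex.
From mathcomp Require Import interval_inference zify ring lra.
Import Order.TTheory GRing.Theory Num.Theory.
Import numFieldNormedType.Exports.

Set Implicit Arguments.
Unset Strict Implicit.
Unset Printing Implicit Defensive.

Local Open Scope classical_set_scope.
Local Open Scope ring_scope.

(** * The corner at a non-lattice vertex *)

(** The region is cut out by infinitely many half-planes, so it is not clear beforehand that it has
    vertices, nor that a lattice point in it is interior to [P0]. Both follow from one estimate: if
    B bounds the l1-distances between doubled vertices of [P0], then at every point of the region a
    functional exceeds its minimum on [P0] by at least its l1-norm divided by 2B. Hence functionals
    of norm at least 2B impose nothing new, and every point of the region has a box of radius 1/(2B)
    around it inside [P0]. The minimum of an integral functional on [P0] is only half-integral; this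
    is the source of the 1/2 both in the coordinates of a non-lattice vertex and in the estimate.
    The two edges at such a vertex are exchanged by the affine involution (x, y) -> (1 - x, y - 2ex
    + e), so what is proved for one edge or one column holds for the other. A vertical segment of
    length at least e/2 contains at least floor(e/2) lattice points; the two columns together give 2
    floor(e/2) >= e - 1 points of [P0], to be compared with e, twice the height. *)

Section FineHull.
Variables (R : realType) (T : Type).
Implicit Types (V : T -> Prop) (X Y : T -> int) (z : R * R).

(* A family of half-integral points is given by its doubled coordinates X v and
   Y v, hence the factor 2: the hypothesis says that k is a lower bound of the
   functional (a, b) on the points (X v / 2, Y v / 2).  The coordinates are
   functions so that a unimodular change of coordinates acts on X and Y. *)
Definition fine_region V X Y z := forall a b k : int, (a != 0) || (b != 0) ->
  (forall v, V v -> 2 * k <= a * X v + b * Y v) ->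
  k%:~R + 1 <= a%:~R * z.1 + b%:~R * z.2.

Lemma intr_lt (a b : int) : (a%:~R : R) < b%:~R -> a + 1 <= b.
Proof. by rewrite ltr_int; lia. Qed.

Lemma intr_le (a b : int) : (a%:~R : R) <= b%:~R -> a <= b.
Proof. by rewrite ler_int. Qed.

(** Functionals pull back along the integral matrix, and the nonzero determinant keeps a nonzero
    functional nonzero. This is one inclusion only; a unimodular change is reversed by applying the
    lemma to its inverse. *)
Lemma fine_frame V X Y z (p q s r t u : int) : p * t - q * r != 0 ->
  fine_region V X Y z ->
  fine_region V (fun v => p * X v + q * Y v + 2 * s) (fun v => r * X v + t * Y v + 2 * u)
    (p%:~R * z.1 + q%:~R * z.2 + s%:~R, r%:~R * z.1 + t%:~R * z.2 + u%:~R).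
Proof.
move=> hd hz a b k hab hk /=.
have := hz (a * p + b * r) (a * q + b * t) (k - a * s - b * u) _ _.
have h1 : (a * p + b * r != 0) || (a * q + b * t != 0).
  apply/negPn; rewrite negb_or !negbK; apply/negP => /andP[/eqP e1 /eqP e2].
  have ea : a * (p * t - q * r) = (a * p + b * r) * t - (a * q + b * t) * r by ring.
  have eb : b * (p * t - q * r) = (a * q + b * t) * p - (a * p + b * r) * q by ring.
  move: ea eb; rewrite e1 e2 !mul0r subrr => /eqP + /eqP.
  rewrite !mulf_eq0 (negPf hd) !orbF => /eqP a0 /eqP b0.
  by move: hab; rewrite a0 b0 eqxx.
move=> /(_ h1) h2.
have /h2 : forall v, V v -> 2 * (k - a * s - b * u)
    <= (a * p + b * r) * X v + (a * q + b * t) * Y v.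
  by move=> v /hk; lia.
rewrite !(intrD, intrM, intrB); lra.
Qed.

(* Shearing so that the functional violated by (1,1) has slope in (0,1], the
   half-integral points on the lines y = 0 and y = 1/2 are forced to x <= 1/2. *)
Lemma half_edge V X Y (x0 : R) :
  (forall v, V v -> 0 <= Y v) -> 0 < x0 < 1 -> fine_region V X Y (x0, 1) ->
  ~ fine_region V X Y (1, 1) ->
  exists s : int,
    [/\ exists v, [/\ V v, X v + s * (Y v - 2) = 1 & Y v = 0],
        forall v, V v -> - 2 <= Y v - 2 * (X v + s * (Y v - 2)) &
        x0 <= 1 / 2].
Proof.
move=> hY /andP[x00 x01] hx; rewrite /fine_region.
move=> /existsNP[a] /existsNP[b] /existsNP[k] /not_implyP[hab] /not_implyP[hk].
rewrite /= => /negP; rewrite -ltNge !mulr1 => hk1.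
have : (a + b)%:~R < ((k + 1)%:~R : R) by rewrite !intrD.
move=> /intr_lt hk2.
have /= hw := hx a b k hab hk.
have hk3 : (a + b)%:~R <= (k%:~R : R) by rewrite ler_int; lia.
move: hk3; rewrite intrD => hk3.
(* The functional is at least k + 1 at (x0, 1) and at most k at (1, 1), while x0 < 1. *)
have a0 : (a%:~R : R) < (0 : int)%:~R by nra.
have {a0}a0 : a < 0 by move: a0; rewrite ltr_int.
(* The shear fixes the line y = 1 (doubled: Y = 2) and replaces b by its residue modulo e; dividing
   b - 1 instead of b selects the residues 1, ..., e. *)
set e := - a; set s := - ((b - 1) %/ e)%Z; exists s.
set b' := b + e * s.
have hb' : 0 < b' <= e.
  have e0 : 0 < e by rewrite /e; lia.
  have := divz_eq (b - 1) e; have := modz_ge0 (b - 1) (lt0r_neq0 e0).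
  have := ltz_pmod (b - 1) e0; rewrite /b' /s; lia.
have hV v : V v -> 2 * (- e + b') <= - e * (X v + s * (Y v - 2)) + b' * Y v.
  by move=> /hk; rewrite /b' /e; lia.
(* If no point on y = 0 has sheared doubled abscissa at least 1, then y - x is nonnegative on the
   family, hence at least 1 at (x0, 1), against x0 > 0. *)
case: (pselect (exists v, [/\ V v, 1 <= X v + s * (Y v - 2) & Y v = 0])); last first.
  move=> hn; exfalso.
  have h v : V v -> X v + s * (Y v - 2) <= Y v.
    move=> Vv; have h1 := hV v Vv; have h2 := hY v Vv.
    have : (Y v == 0) || (Y v == 1) || (2 <= Y v) by lia.
    move=> /orP[/orP[/eqP y0|/eqP y1]|y2].
    - have : ~ 1 <= X v + s * (Y v - 2) by move=> h3; apply: hn; exists v; split.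
      lia.
    - rewrite y1 in h1 *; nia.
    - nia.
  have /= h3 := hx (-1) (1 - s) (- s) isT.
  have /h3 : forall v, V v -> 2 * - s <= -1 * X v + (1 - s) * Y v.
    by move=> v /h; lia.
  rewrite !(intrD, intrM, intrB, intrN); lra.
move=> [p [Vp p1 p0]].
(* As b' > 0, the doubled abscissa of p is below 2, hence equal to 1, and the same inequality then
   reads 2b' <= e. *)
have hp := hV p Vp; rewrite p0 in hp p1.
have px : X p + s * (0 - 2) = 1 by nia.
have hbe : 2 * b' <= e by rewrite px in hp; lia.
have hh v : V v -> - 2 <= Y v - 2 * (X v + s * (Y v - 2)).
  move=> Vv; have h1 := hV v Vv; have h2 := hY v Vv.
  move: h1; set x := X v + _ => h1.
  have : (Y v == 0) || (Y v == 1) || (2 <= Y v) by lia.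
  move=> /orP[/orP[/eqP y0|/eqP y1]|y2].
  - rewrite y0 in h1 *; nia.
  - rewrite y1 in h1 *; nia.
  - suff : 0 <= e * ((Y v - 2) - 2 * (x - 2)) by nia.
    nia.
split; first by exists p; rewrite p0.
- exact: hh.
have /= := hx (-2) (1 - 2 * s) (- 1 - 2 * s) isT.
have h4 : forall v, V v -> 2 * (- 1 - 2 * s) <= -2 * X v + (1 - 2 * s) * Y v.
  by move=> v /hh; lia.
move=> /(_ h4).
rewrite !(intrD, intrM, intrB, intrN); lra.
Qed.

(** The second edge functional is -d x + c y. After the shear its coefficient C of y is at most 1,
    because the point (1/2, 0) bounds its lower bound K by -d/2 and x0 <= 1/2. If C <= 0, the family
    lies in x <= 1, which forces x0 <= 0. With C = 1, K = -d x0 and K <= -d/2 give x0 >= 1/2; then e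
    = -K. *)
Lemma half_corner V X Y (x0 : R) (d c k : int) :
  (forall v, V v -> 0 <= Y v) -> 0 < x0 < 1 -> fine_region V X Y (x0, 1) ->
  0 < d -> (forall v, V v -> 2 * k <= - d * X v + c * Y v) ->
  k%:~R + 1 = - d%:~R * x0 + c%:~R ->
  exists s e : int,
    [/\ x0 = 1 / 2, 0 < e, d = 2 * e /\ c + d * s = 1,
        exists v, [/\ V v, X v + s * (Y v - 2) = 1 & Y v = 0] &
        forall v, V v -> - (2 * e) <= Y v - 2 * e * (X v + s * (Y v - 2))].
Proof.
move=> hY hx0 hx d0 hV hk; have /andP[x00 x01] := hx0.
have dR : (0 : R) < d%:~R by rewrite ltr0z.
have h11 : ~ fine_region V X Y (1, 1).
  move=> /(_ (- d) c k); rewrite oppr_eq0 gt_eqF //= => h.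
  have := h _ hV; rewrite intrN; nra.
have [s [[p [Vp p1 p0]] hs xl]] := half_edge hY hx0 hx h11.
exists s.
pose C := c + d * s; pose K := k + d * s.
have hV' v : V v -> 2 * K <= - d * (X v + s * (Y v - 2)) + C * Y v.
  move=> /hV; rewrite (_ : _ + C * Y v = - d * X v + c * Y v + 2 * d * s).
    by rewrite /K; lia.
  by rewrite /C; ring.
have hK : K%:~R + 1 = - d%:~R * x0 + C%:~R by rewrite /K /C !intrD !intrM; lra.
have h1 : 2 * K <= - d by have := hV' p Vp; rewrite p1 p0; lia.
have h1R : 2 * (K%:~R : R) <= - d%:~R.
  by move: h1; rewrite -(ler_int R) intrM intrN.
have cR : C%:~R <= (1 : int)%:~R :> R by nra.
have {cR} c1 := intr_le cR.
have hi : (C - K - 1)%:~R < (d%:~R : R) by rewrite !intrB; nra.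
have {}hi := intr_lt hi.
have [c0|c0] := leP C 0.
  exfalso.
  have h v : V v -> X v <= 2 + s * 2 - s * Y v.
    move=> Vv; have := hs v Vv; have := hV' v Vv.
    move: (hY v Vv); set x := X v + _ => h2 h3 h4.
    suff : x <= 2 by rewrite /x; lia.
    have : (d - 2 * C) * x <= 2 * (d - 2 * C) by nia.
    by rewrite mulrC ler_pM2r //; lia.
  have /= := hx (-1) (- s) (- 1 - s) isT.
  have h4 : forall v, V v -> 2 * (- 1 - s) <= -1 * X v + - s * Y v.
    by move=> v /h; lia.
  move=> /(_ h4); rewrite !(intrB, intrN); lra.
have eC : C = 1 by lia.
rewrite eC in hK hi hV'; rewrite mulr1z in hK.
have x0e : x0 = 1 / 2.
  apply: le_anti; rewrite xl /=.
  have : d%:~R * (1 / 2) <= d%:~R * x0 by lra.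
  by rewrite ler_pM2l.
have hd : d = - (2 * K).
  have : (d%:~R : R) = (- (2 * K))%:~R by rewrite intrN intrM; rewrite x0e in hK; lra.
  by move/eqP; rewrite eqr_int => /eqP.
exists (- K); split => //; first lia.
  by split; [lia|exact: eC].
  by exists p.
by move=> v /hV'; rewrite hd; lia.
Qed.

(** * Lattice neighbours of the vertex and columns of lattice points *)

Definition convex_pred (K : R * R -> Prop) := forall z z' (l : R), 0 <= l <= 1 ->
  K z -> K z' -> K (l * z.1 + (1 - l) * z'.1, l * z.2 + (1 - l) * z'.2).

Lemma fine_convex V X Y : convex_pred (fine_region V X Y).
Proof.
move=> z z' l hl hz hz' a b k hab hk /=.
by have := hz a b k hab hk; have := hz' a b k hab hk; nra.
Qed.

Lemma fine_ext V X Y X' Y' z z' : X =1 X' -> Y =1 Y' -> z = z' ->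
  fine_region V X Y z -> fine_region V X' Y' z'.
Proof.
move=> eX eY <- hz a b k hab hk; apply: hz => // v /hk.
by rewrite eX eY.
Qed.

(** Divide (a, b) by its gcd g. Rounding the bound of the quotient to an integer loses at most g/2
    after multiplication by g, and g/2 <= g - 1 once g >= 2. The size bounds keep the quotient
    inside a given finite range of functionals. *)
Lemma fine_primitive V X Y z (a b : int) : (a != 0) || (b != 0) ->
  exists a' b' : int, [/\ coprimez a' b', `|a'| <= `|a|, `|b'| <= `|b| &
    (forall k : int, (forall v, V v -> 2 * k <= a' * X v + b' * Y v) ->
       k%:~R + 1 <= a'%:~R * z.1 + b'%:~R * z.2) ->
    forall k : int, (forall v, V v -> 2 * k <= a * X v + b * Y v) ->
       k%:~R + 1 <= a%:~R * z.1 + b%:~R * z.2].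
Proof.
move=> hab.
have [u [v huv]] := Bezoutz a b.
set g := gcdz a b in huv.
have g0 : 0 < g.
  have : g != 0 by rewrite gcdz_eq0 negb_and.
  by rewrite lt0r => ->.
have ea : a = g * (a %/ g)%Z by rewrite mulrC divzK ?dvdz_gcdl.
have eb : b = g * (b %/ g)%Z by rewrite mulrC divzK ?dvdz_gcdr.
move: ea eb; move: (a %/ g)%Z (b %/ g)%Z => a' b' ea eb.
have cab : coprimez a' b'.
  apply/coprimezP; exists (u, v) => /=.
  apply: (mulfI (lt0r_neq0 g0)); rewrite mulr1 -[RHS]huv ea eb; ring.
have gn x : `|x| <= `|g * x|.
  by rewrite normrM ler_peMl // gtr0_norm // -gtz0_ge1.
exists a', b'; split => //; rewrite ?ea ?eb //.
move=> hz k hk.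
have [g1|g2] : g = 1 \/ 2 <= g by lia.
  by move: hk; rewrite g1 !mul1r => /hz.
(* M is 2k / g rounded up. *)
pose M := - ((- (2 * k)) %/ g)%Z.
have hM1 : 2 * k <= g * M.
  have := divz_eq (- (2 * k)) g; have := modz_ge0 (- (2 * k)) (lt0r_neq0 g0).
  by rewrite /M; lia.
have hM2 : g * M < 2 * k + g.
  have := divz_eq (- (2 * k)) g; have := ltz_pmod (- (2 * k)) g0.
  by rewrite /M; lia.
have hV w : V w -> M <= a' * X w + b' * Y w.
  move=> /hk => h.
  have : g * (M - 1) < g * (a' * X w + b' * Y w) by lia.
  by rewrite ltr_pM2l // ; lia.
pose k' := (M %/ 2)%Z.
have hk' : 2 * k' <= M <= 2 * k' + 1 by rewrite /k'; lia.
have := hz k' _.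
have h : forall w, V w -> 2 * k' <= a' * X w + b' * Y w.
  by move=> w /hV; lia.
move=> /(_ h) hzz.
have hkk : k + 1 <= g * (k' + 1) by nia.
have : (k + 1)%:~R <= (g * (k' + 1))%:~R :> R by rewrite ler_int.
have gR : (0 : R) < g%:~R by rewrite ltr0z.
rewrite !(intrD, intrM) mulr1z; nra.
Qed.

(** For x1 <= 0 this is convexity. Otherwise the reflection x -> 1 - x carries (0, 1) to (1, 1);
    were that point outside the reflected region, [half_edge] would give 1 - x1 <= 1/2. *)
Lemma fine_left V X Y (x1 : R) :
  (forall v, V v -> 0 <= Y v) -> fine_region V X Y (1 / 2 : R, 1) ->
  fine_region V X Y (x1, 1) -> x1 < 1 / 2 -> fine_region V X Y (0 : R, 1).
Proof.
move=> hY hw h1 x1h; case: (leP x1 0) => x10.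
  have d0 : 0 < 1 / 2 - x1 by lra.
  have hl : 0 <= (1 / 2) / (1 / 2 - x1) <= 1.
    by apply/andP; split; [apply: divr_ge0; lra|rewrite ler_pdivrMr //; lra].
  have := fine_convex hl h1 hw; apply: fine_ext => //=.
  by congr pair; [field; rewrite gt_eqF //; lra|ring].
apply: contrapT => hn.
pose X' v := -1 * X v + 0 * Y v + 2 * 1.
pose Y' v := 0 * X v + 1 * Y v + 2 * 0.
have fr z : fine_region V X Y z -> fine_region V X' Y' (1 - z.1, z.2).
  move=> hz; have := @fine_frame V X Y z (-1) 0 1 0 1 0 isT hz.
  by apply: fine_ext => //; congr pair; rewrite ?mulrNz; ring.
have fr' z : fine_region V X' Y' z -> fine_region V X Y (1 - z.1, z.2).
  move=> hz; have := @fine_frame V X' Y' z (-1) 0 1 0 1 0 isT hz.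
  apply: fine_ext => [v|v|]; rewrite /X' /Y'; try ring.
  by congr pair; rewrite ?mulrNz; ring.
have hY' v : V v -> 0 <= Y' v by move=> /hY; rewrite /Y'; lia.
have h2 := fr _ h1.
have [||s [_ _ h3]] := half_edge hY' _ h2.
- by rewrite /=; lra.
- by move=> /fr' /=; rewrite subrr.
- by move: h3 => /=; lra.
Qed.

(** The involution exchanging the two edge lines carries (0, 1) to (1, e + 1), so the second claim
    is [fine_left] on the other edge. *)
Lemma fine_corner V X Y (e : int) (x1 x2 y2 : R) : 0 < e ->
  (forall v, V v -> 0 <= Y v) ->
  (forall v, V v -> - (2 * e) <= Y v - 2 * e * X v) ->
  fine_region V X Y (1 / 2 : R, 1) ->
  fine_region V X Y (x1, 1) -> x1 < 1 / 2 ->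
  fine_region V X Y (x2, y2) -> 1 / 2 < x2 -> y2 - 2 * e%:~R * x2 = 1 - e%:~R ->
  fine_region V X Y (0 : R, 1) /\ fine_region V X Y (1 : R, e%:~R + 1).
Proof.
move=> e0 hY hE hw h1 x1h h2 x2h y2h; split; first exact: fine_left hw h1 x1h.
pose X' v := -1 * X v + 0 * Y v + 2 * 1.
pose Y' v := (- (2 * e)) * X v + 1 * Y v + 2 * e.
have hd : -1 * 1 - 0 * - (2 * e) != 0 by rewrite mul0r.
have fr z : fine_region V X Y z -> fine_region V X' Y' (1 - z.1, z.2 - 2 * e%:~R * z.1 + e%:~R).
  move=> hz; have := @fine_frame V X Y z (-1) 0 1 (- (2 * e)) 1 e hd hz.
  by apply: fine_ext => //; congr pair; rewrite ?mulrNz ?intrM; ring.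
have fr' z : fine_region V X' Y' z -> fine_region V X Y (1 - z.1, z.2 + 2 * e%:~R * (1 - z.1) - e%:~R).
  move=> hz; have := @fine_frame V X' Y' z (-1) 0 1 (- (2 * e)) 1 e hd hz.
  apply: fine_ext => [v|v|]; rewrite /X' /Y'; try ring.
  by congr pair; rewrite ?mulrNz ?intrM; ring.
have hY' v : V v -> 0 <= Y' v by move=> /hE; rewrite /Y'; lia.
have hw' : fine_region V X' Y' (1 / 2 : R, 1).
  by have := fr _ hw; apply: fine_ext => //=; congr pair; field.
have h2' : fine_region V X' Y' (1 - x2, 1).
  by have := fr _ h2; apply: fine_ext => //=; congr pair; lra.
have := fine_left hY' hw' h2' ltac:(lra).
move=> /fr'; apply: fine_ext => //=; congr pair; ring.
Qed.

Lemma fine_cone V X Y (e : int) z :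
  (forall v, V v -> 0 <= Y v) ->
  (forall v, V v -> - (2 * e) <= Y v - 2 * e * X v) -> fine_region V X Y z ->
  1 <= z.2 /\ 1 - e%:~R <= z.2 - 2 * e%:~R * z.1.
Proof.
move=> hY hE hz; split.
  have := hz 0 1 0 isT _; rewrite mulr0z mul0r mulr1z !add0r mul1r; apply.
  by move=> v /hY; lia.
have := hz (- (2 * e)) 1 (- e) _ _; rewrite orbT => /(_ isT); rewrite !mulrNz intrM => h.
have {h}/h : forall v, V v -> 2 * - e <= - (2 * e) * X v + 1 * Y v.
  by move=> v /hE; lia.
by lra.
Qed.

(* The segments from (1/2,0) and from (1/2+t,y2) to (1/2-s,y1) cross the line
   x = 0 at heights differing by at least e/2. *)
Lemma column_points (K : R * R -> Prop) (e : int) (s t y1 y2 : R) (m : nat) :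
  convex_pred K -> 0 < e -> 2 * m%:R <= (e%:~R : R) -> 1 <= s -> 1 <= t -> 0 <= y1 -> 2 * e%:~R * t <= y2 ->
  K (1 / 2, 0) -> K (1 / 2 - s, y1) -> K (1 / 2 + t, y2) ->
  exists A : int, forall i : nat, (i < m)%N -> K (0, A%:~R + i%:R).
Proof.
move=> cK e0 hm s1 t1 hy1 hy2 K0 K1 K2.
have eR : (0 : R) < e%:~R by rewrite ltr0z.
pose L := y1 / (2 * s); pose U := ((t + 1 / 2) * y1 + (s - 1 / 2) * y2) / (s + t).
have KL : K (0, L).
  have hl : 0 <= 1 / (2 * s) <= 1.
    by apply/andP; split; [apply: divr_ge0; lra|rewrite ler_pdivrMr; lra].
  have := cK _ _ _ hl K1 K0.
  by congr (K _); congr pair; rewrite /L /=; field; rewrite gt_eqF //; lra.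
have KU : K (0, U).
  have hl : 0 <= (t + 1 / 2) / (s + t) <= 1.
    by apply/andP; split; [apply: divr_ge0; lra|rewrite ler_pdivrMr; lra].
  have := cK _ _ _ hl K1 K2.
  by congr (K _); congr pair; rewrite /U /=; field; rewrite gt_eqF //; lra.
have hLU : e%:~R / 2 <= U - L.
  have -> : U - L = (t * (2 * s - 1) * y1 + s * (2 * s - 1) * y2) / (2 * s * (s + t)).
    by rewrite /U /L; field; rewrite !gt_eqF //; lra.
  rewrite ler_pdivlMr; last by apply: mulr_gt0; lra.
  have h1 : 0 <= t * (2 * s - 1) * y1.
    by apply: mulr_ge0 => //; apply: mulr_ge0; lra.
  have h2 : s * (2 * s - 1) * (2 * e%:~R * t) <= s * (2 * s - 1) * y2.
    by apply: ler_wpM2l => //; apply: mulr_ge0; lra.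
  have h3 : s * (s + t) <= s * ((2 * s - 1) * (2 * t)).
    by apply: ler_wpM2l; nra.
  have : e%:~R * (s * (s + t)) <= e%:~R * (s * ((2 * s - 1) * (2 * t))).
    by apply: ler_wpM2l => //; lra.
  by nra.
(* As L rounded up is less than L + 1, the m consecutive integers from there on stay below L + m,
   which is at most U. *)
exists (Num.ceil L) => i im.
have hc := ceil_ge L; have hc2 := ceilB1_lt L.
set y : R := _ + _.
have hi : (i%:R : R) + 1 <= m%:R by rewrite natr1 ler_nat.
have yL : L <= y by rewrite /y; have : (0 : R) <= i%:R by []; lra.
have yU : y <= U by rewrite /y; move: hc2; rewrite intrB mulr1z; lra.
have LU : L < U by lra.
have hl : 0 <= (y - L) / (U - L) <= 1.
  by apply/andP; split; [apply: divr_ge0; lra|rewrite ler_pdivrMr; lra].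
have := cK _ _ _ hl KU KL.
by congr (K _); congr pair; rewrite /=; field; rewrite gt_eqF //; lra.
Qed.

(** The convex hull of the half-integral points, encoded as the intersection of all convex
    predicates containing them, so that an affine map acts by substitution in the predicate. *)
Definition half_hull V X Y z := forall K : R * R -> Prop, convex_pred K ->
  (forall v, V v -> K ((X v)%:~R / 2, (Y v)%:~R / 2)) -> K z.

Lemma half_hull_convex V X Y : convex_pred (half_hull V X Y).
Proof.
move=> z z' l hl hz hz' K cK hK.
exact: cK (hz _ cK hK) (hz' _ cK hK).
Qed.

Lemma half_hull_gen V X Y v : V v -> half_hull V X Y ((X v)%:~R / 2, (Y v)%:~R / 2).
Proof. by move=> Vv K _; apply. Qed.

Lemma half_hull_frame V X Y (p q s r t u : int) z :
  half_hull V X Y z ->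
  half_hull V (fun v => p * X v + q * Y v + 2 * s) (fun v => r * X v + t * Y v + 2 * u)
    (p%:~R * z.1 + q%:~R * z.2 + s%:~R, r%:~R * z.1 + t%:~R * z.2 + u%:~R).
Proof.
move=> hz K cK hK.
pose K' z := K (p%:~R * z.1 + q%:~R * z.2 + s%:~R, r%:~R * z.1 + t%:~R * z.2 + u%:~R).
apply: (hz K') => [z1 z2 l hl h1 h2|v Vv].
  have := cK _ _ l hl h1 h2; rewrite /K' /=.
  by congr (K _); congr pair; ring.
have := hK v Vv; rewrite /K' /= !(intrD, intrM).
by congr (K _); congr pair; field.
Qed.

Lemma half_hull_ext V X Y X' Y' z z' : X =1 X' -> Y =1 Y' -> z = z' ->
  half_hull V X Y z -> half_hull V X' Y' z'.
Proof.
move=> eX eY <- hz K cK hK; apply: hz => // v Vv.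
by rewrite eX eY; apply: hK.
Qed.

(** The functional x at (0, 1) forces a point of the family with doubled abscissa at most -1, and -x
    at (1, e + 1) forces one with doubled abscissa at least 3. These are the outer points of
    [column_points]. *)
Lemma left_column V X Y (e : int) (m : nat) : 0 < e -> 2 * m%:Z <= e ->
  (forall v, V v -> 0 <= Y v) ->
  (forall v, V v -> - (2 * e) <= Y v - 2 * e * X v) ->
  (exists v, [/\ V v, X v = 1 & Y v = 0]) ->
  fine_region V X Y (0 : R, 1) -> fine_region V X Y (1 : R, e%:~R + 1) ->
  exists A : int, forall i : nat, (i < m)%N -> half_hull V X Y (0 : R, A%:~R + i%:R).
Proof.
move=> e0 hm hY hE [p [Vp pX pY]] h0 h1.
have [v1 [V1 x1]] : exists v, V v /\ X v <= - 1.
  apply: contrapT => hn; have := h0 1 0 0 isT.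
  have h : forall v, V v -> 2 * 0 <= 1 * X v + 0 * Y v.
    move=> v Vv; have : ~ X v <= - 1 by move=> xv; apply: hn; exists v.
    lia.
  move=> /(_ h) /=; lra.
have [v2 [V2 x2]] : exists v, V v /\ 3 <= X v.
  apply: contrapT => hn; have := h1 (-1) 0 (-1) isT.
  have h : forall v, V v -> 2 * -1 <= -1 * X v + 0 * Y v.
    move=> v Vv; have : ~ 3 <= X v by move=> xv; apply: hn; exists v.
    lia.
  move=> /(_ h) /=; rewrite intrN; lra.
have hmR : 2 * (m%:R : R) <= e%:~R.
  by move: hm; rewrite -(ler_int R) intrM.
have X1 : ((X v1)%:~R : R) <= -1 by move: x1; rewrite -(ler_int R) intrN.
have X2 : (3 : R) <= (X v2)%:~R by move: x2; rewrite -(ler_int R).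
have Y1 : (0 : R) <= (Y v1)%:~R by rewrite ler0z hY.
have Y2 : - (2 * e%:~R) <= (Y v2)%:~R - 2 * e%:~R * (X v2)%:~R :> R.
  by have := hE _ V2; rewrite -(ler_int R) intrN intrB !intrM.
have eR : (0 : R) < e%:~R by rewrite ltr0z.
apply: (@column_points (half_hull V X Y) e (1 / 2 - (X v1)%:~R / 2)
  ((X v2)%:~R / 2 - 1 / 2) ((Y v1)%:~R / 2) ((Y v2)%:~R / 2) m) => //.
- exact: half_hull_convex.
- lra.
- lra.
- lra.
- lra.
- by have := @half_hull_gen V X Y _ Vp; apply: half_hull_ext => //; rewrite pX pY mul0r.
- by have := @half_hull_gen V X Y _ V1; apply: half_hull_ext => //; congr pair; lra.
- by have := @half_hull_gen V X Y _ V2; apply: half_hull_ext => //; congr pair; lra.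
Qed.

Lemma two_columns V X Y (e : int) (m : nat) : 0 < e -> 2 * m%:Z <= e ->
  (forall v, V v -> 0 <= Y v) ->
  (forall v, V v -> - (2 * e) <= Y v - 2 * e * X v) ->
  (exists v, [/\ V v, X v = 1 & Y v = 0]) ->
  fine_region V X Y (0 : R, 1) -> fine_region V X Y (1 : R, e%:~R + 1) ->
  exists A B : int, forall i : nat, (i < m)%N ->
    half_hull V X Y (0 : R, A%:~R + i%:R) /\ half_hull V X Y (1 : R, B%:~R + i%:R).
Proof.
move=> e0 hm hY hE hp h0 h1.
have [A hA] := left_column e0 hm hY hE hp h0 h1; exists A.
pose X' v := -1 * X v + 0 * Y v + 2 * 1.
pose Y' v := (- (2 * e)) * X v + 1 * Y v + 2 * e.
have hd : -1 * 1 - 0 * - (2 * e) != 0 by rewrite mul0r.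
have fr z : fine_region V X Y z -> fine_region V X' Y' (1 - z.1, z.2 - 2 * e%:~R * z.1 + e%:~R).
  move=> hz; have := @fine_frame V X Y z (-1) 0 1 (- (2 * e)) 1 e hd hz.
  by apply: fine_ext => //; congr pair; rewrite ?mulrNz ?intrM; ring.
have fr' z : half_hull V X' Y' z -> half_hull V X Y (1 - z.1, z.2 + 2 * e%:~R * (1 - z.1) - e%:~R).
  move=> hz; have := @half_hull_frame V X' Y' (-1) 0 1 (- (2 * e)) 1 e _ hz.
  apply: half_hull_ext => [v|v|]; rewrite /X' /Y'; try ring.
  by congr pair; rewrite ?mulrNz ?intrM; ring.
have [||||| B hB] := @left_column V X' Y' e m e0 hm.
- by move=> v /hE; rewrite /Y'; lia.
- by move=> v /hY; rewrite /Y' /X'; lia.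
- have [p [Vp pX pY]] := hp; exists p; split=> //; rewrite /X' /Y' pX ?pY; lia.
- by have := fr _ h1; apply: fine_ext => //=; congr pair; ring.
- by have := fr _ h0; apply: fine_ext => //=; congr pair; ring.
(* The involution takes (0, B + i) to (1, B + e + i). *)
exists (B + e) => i im; split; first exact: hA.
have := fr' _ (hB _ im); apply: half_hull_ext => //=; congr pair; rewrite ?intrD; ring.
Qed.

(** * The corner in arbitrary coordinates *)

Definition integral z := exists i j : int, z = (i%:~R, j%:~R).

(** Bezout coefficients complete the primitive functional (a1, b1) to a unimodular frame in which
    its edge line is y = 1. The points w' and w'' certify that both tight lines meet the region
    beyond w, which is what brings the lattice neighbours (0, 1) and (1, e + 1) into it. *)
Lemma corner_frame V X Y (w w' w'' : R * R) (a1 b1 k1 a2 b2 k2 : int) :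
  coprimez a1 b1 -> a1 * b2 - a2 * b1 != 0 ->
  (forall v, V v -> 2 * k1 <= a1 * X v + b1 * Y v) ->
  (forall v, V v -> 2 * k2 <= a2 * X v + b2 * Y v) ->
  a1%:~R * w.1 + b1%:~R * w.2 = k1%:~R + 1 ->
  a2%:~R * w.1 + b2%:~R * w.2 = k2%:~R + 1 ->
  fine_region V X Y w -> ~ integral w ->
  fine_region V X Y w' -> w' <> w -> a1%:~R * w'.1 + b1%:~R * w'.2 = k1%:~R + 1 ->
  fine_region V X Y w'' -> w'' <> w -> a2%:~R * w''.1 + b2%:~R * w''.2 = k2%:~R + 1 ->
  exists p q s r t u e : int,
    let X' v := p * X v + q * Y v + 2 * s in
    let Y' v := r * X v + t * Y v + 2 * u in
    [/\ (p * t - q * r) ^+ 2 = 1 /\ 0 < e,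
        p%:~R * w.1 + q%:~R * w.2 + s%:~R = 1 / 2 /\ r%:~R * w.1 + t%:~R * w.2 + u%:~R = 1,
        (forall v, V v -> 0 <= Y' v) /\
        (forall v, V v -> - (2 * e) <= Y' v - 2 * e * X' v),
        exists v, [/\ V v, X' v = 1 & Y' v = 0] &
        fine_region V X' Y' (0 : R, 1) /\ fine_region V X' Y' (1 : R, e%:~R + 1)].
Proof.
move=> /coprimezP[[u0 v0] /= huv] hdet hV1 hV2 hw1 hw2 fw wI fw' ww' hw' fw'' ww'' hw''.
(* This sign will be the determinant of the frame; it is chosen so that the second functional has a
   negative coefficient -d of x. *)
pose ep : int := if 0 < a2 * b1 - b2 * a1 then -1 else 1.
have ep2 : ep * ep = 1 by rewrite /ep; case: ifP.
pose p := ep * v0; pose q := - (ep * u0).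
have hD : p * b1 - q * a1 = ep.
  by rewrite /p /q -[RHS]mulr1 -huv; ring.
clearbody p q.
pose d := - (ep * (a2 * b1 - b2 * a1)).
have d0 : 0 < d by rewrite /d /ep; case: ifP; lia.
pose c := ep * (b2 * p - a2 * q).
(* A translation puts the abscissa of w into [0, 1). The value 0 would make w integral, since the
   frame is unimodular. *)
have [s hs] : exists s : int, 0 <= p%:~R * w.1 + q%:~R * w.2 + s%:~R < 1.
  exists (- Num.floor (p%:~R * w.1 + q%:~R * w.2)).
  have h1 := floor_le (p%:~R * w.1 + q%:~R * w.2).
  have := floorD1_gt (p%:~R * w.1 + q%:~R * w.2).
  by rewrite intrN intrD mulr1z; lra.
pose X1 v := p * X v + q * Y v + 2 * s.
pose Y1 v := a1 * X v + b1 * Y v + 2 * (- k1).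
have hD0 : p * b1 - q * a1 != 0 by rewrite hD /ep; case: ifP.
have fr z := @fine_frame V X Y z p q s a1 b1 (- k1) hD0.
set x0 := p%:~R * w.1 + q%:~R * w.2 + s%:~R.
have ea2 : a2 = - d * p + c * a1.
  rewrite -[LHS]mulr1 -ep2 /d /c -{1}hD; ring.
have eb2 : b2 = - d * q + c * b1.
  rewrite -[LHS]mulr1 -ep2 /d /c -{1}hD; ring.
clearbody d c.
have hDR : p%:~R * b1%:~R - q%:~R * a1%:~R = ep%:~R :> R.
  by rewrite -!intrM -intrB hD.
have epR : ep%:~R * ep%:~R = 1 :> R by rewrite -intrM ep2.
have x00 : x0 != 0.
  apply/eqP => e0; apply: wI.
  exists (ep * (b1 * - s - q * (k1 + 1))), (ep * (p * (k1 + 1) - a1 * - s)).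
  have es : s%:~R = - (p%:~R * w.1 + q%:~R * w.2) :> R by move: e0; rewrite /x0; lra.
  have ek : k1%:~R = a1%:~R * w.1 + b1%:~R * w.2 - 1 :> R by lra.
  rewrite [LHS]surjective_pairing; congr pair.
    rewrite intrM -[LHS]mul1r -[X in X * _]epR -mulrA; congr (_ * _).
    by rewrite -hDR !(intrB, intrM, intrN, intrD) es ek; ring.
  rewrite intrM -[LHS]mul1r -[X in X * _]epR -mulrA; congr (_ * _).
  by rewrite -hDR !(intrB, intrM, intrN, intrD) es ek; ring.
have hx0 : 0 < x0 < 1.
  by move: hs; rewrite [0 < _]lt_neqAle eq_sym x00.
have fx0 : fine_region V X1 Y1 (x0, 1).
  by have := fr _ fw; apply: fine_ext => //; congr pair; rewrite intrN; lra.
have hV1' v : V v -> 0 <= Y1 v by move=> /hV1; rewrite /Y1; lia.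
have hV2' v : V v -> 2 * (k2 - d * s - c * k1) <= - d * X1 v + c * Y1 v.
  by move=> /hV2; rewrite /X1 /Y1 ea2 eb2; lia.
have hx0e : (k2 - d * s - c * k1)%:~R + 1 = - d%:~R * x0 + c%:~R.
  rewrite !(intrB, intrM).
  suff : k2%:~R + 1 = - d%:~R * (x0 - s%:~R) + c%:~R * (k1%:~R + 1) :> R by lra.
  rewrite -hw2 -hw1 ea2 eb2 /x0 !(intrD, intrM, intrN); ring.
have [s' [e [x0h e0 [de cs] hv hE]]] := half_corner hV1' hx0 fx0 d0 hV2' hx0e.
(* The frame composed with the shear about y = 1 found by [half_corner]. *)
pose pp := p + s' * a1; pose qq := q + s' * b1; pose ss := s - s' * k1 - s'.
pose X' v := pp * X v + qq * Y v + 2 * ss.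
exists pp, qq, ss, a1, b1, (- k1), e => /=.
have eX' v : X' v = X1 v + s' * (Y1 v - 2).
  by rewrite /X' /X1 /Y1 /pp /qq /ss; ring.
have hdet' : (pp * b1 - qq * a1) = ep by rewrite -hD /pp /qq; ring.
have fr' z := @fine_frame V X Y z pp qq ss a1 b1 (- k1).
have {}fr' z := fr' z ltac:(by rewrite hdet' -hD).
have hwx : pp%:~R * w.1 + qq%:~R * w.2 + ss%:~R = 1 / 2.
  rewrite /pp /qq /ss !(intrD, intrN, intrM) -x0h /x0.
  have -> : k1%:~R = a1%:~R * w.1 + b1%:~R * w.2 - 1 :> R by lra.
  ring.
have hE' : forall v, V v -> - (2 * e) <= Y1 v - 2 * e * X' v.
  by move=> v /hE; rewrite eX'.
have inj z : pp%:~R * z.1 + qq%:~R * z.2 + ss%:~R = 1 / 2 ->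
    a1%:~R * z.1 + b1%:~R * z.2 + (- k1)%:~R = 1 -> z = w.
  move=> e1 e2; rewrite [LHS]surjective_pairing [RHS]surjective_pairing.
  have hDR' : pp%:~R * b1%:~R - qq%:~R * a1%:~R = ep%:~R :> R.
    by rewrite -!intrM -intrB hdet'.
  have e3 : pp%:~R * z.1 + qq%:~R * z.2 = pp%:~R * w.1 + qq%:~R * w.2 by lra.
  have e4 : a1%:~R * z.1 + b1%:~R * z.2 = a1%:~R * w.1 + b1%:~R * w.2.
    by move: e2; rewrite intrN; lra.
  have ep0 : ep%:~R != 0 :> R.
    by apply/eqP => h; move: epR => /eqP; rewrite h mul0r eq_sym oner_eq0.
  congr pair; apply: (mulfI ep0); rewrite -hDR'.
    have h z' : (pp%:~R * b1%:~R - qq%:~R * a1%:~R) * z'.1 = b1%:~R * (pp%:~R * z'.1 + qq%:~R * z'.2) - qq%:~R * (a1%:~R * z'.1 + b1%:~R * z'.2) :> R by ring.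
    by rewrite !h e3 e4.
  have h z' : (pp%:~R * b1%:~R - qq%:~R * a1%:~R) * z'.2 = pp%:~R * (a1%:~R * z'.1 + b1%:~R * z'.2) - a1%:~R * (pp%:~R * z'.1 + qq%:~R * z'.2) :> R by ring.
  by rewrite !h e3 e4.
have eR : (0 : R) < e%:~R by rewrite ltr0z.
have fcone z : fine_region V X Y z -> _ := fun hz => fine_cone hV1' hE' (fr' z hz).
split=> //.
- by split => //; rewrite hdet' expr2.
- by split => //; rewrite intrN; lra.
- have [v [Vv v1 v2]] := hv; exists v; split => //.
  by rewrite -[LHS]/(X' v) eX'.
apply: (@fine_corner V X' Y1 e (pp%:~R * w'.1 + qq%:~R * w'.2 + ss%:~R)
  (pp%:~R * w''.1 + qq%:~R * w''.2 + ss%:~R) (a1%:~R * w''.1 + b1%:~R * w''.2 + (- k1)%:~R)) => //.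
- by have := fr' _ fw; apply: fine_ext => //; congr pair; rewrite ?hwx // intrN; lra.
- by have := fr' _ fw'; apply: fine_ext => //; congr pair; rewrite ?hwx // intrN; lra.
- have [_ /=] := fcone _ fw'; set x := pp%:~R * _ + _ + _.
  rewrite intrN hw' => h.
  have : 2 * e%:~R * x <= 2 * e%:~R * (1 / 2) by lra.
  rewrite ler_pM2l; last by lra.
  rewrite le_eqVlt => /orP[/eqP h2|//]; case: ww'.
  by apply: inj => //; rewrite intrN; lra.
- by have := fr' _ fw''; apply: fine_ext.
all: have [/=] := fcone _ fw''; set x := pp%:~R * _ + _ + _; set y := a1%:~R * _ + _ + _ => h1 h2.
all: have h3 : y - 2 * e%:~R * x = 1 - e%:~R.
  1,3: have -> : e%:~R = d%:~R / 2 :> R by rewrite de intrM; field.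
  1,2: suff : - d%:~R * x + y = - d%:~R * (1 / 2) + 1 by lra.
  1,2: have cR : c%:~R = 1 - d%:~R * s'%:~R :> R by have : c%:~R + d%:~R * s'%:~R = 1 :> R; [rewrite -intrM -intrD cs|lra].
  1,2: have : a2%:~R * w''.1 + b2%:~R * w''.2 = a2%:~R * w.1 + b2%:~R * w.2 by rewrite hw2.
  1,2: rewrite -hwx ea2 eb2 /x /y /pp /qq /ss !(intrD, intrM, intrN) cR.
  1,2: have : k1%:~R = a1%:~R * w.1 + b1%:~R * w.2 - 1 :> R by lra.
  1,2: move=> ->; lra.
- have : 2 * e%:~R * (1 / 2) <= 2 * e%:~R * x by lra.
  rewrite ler_pM2l; last by lra.
  rewrite le_eqVlt => /orP[/eqP h4|//]; case: ww''.
  by apply: inj; [rewrite h4|move: h3; rewrite -h4; rewrite /y; lra].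
- exact: h3.
Qed.

(** A certificate of lying on the boundary: such a z is not interior to any set contained in the
    region. *)
Definition tight V X Y z := exists a b k : int,
  [/\ (a != 0) || (b != 0), forall v, V v -> 2 * k <= a * X v + b * Y v &
      a%:~R * z.1 + b%:~R * z.2 = k%:~R + 1].

(* a and b are the lattice points next to w on the two edges at w, and the line
   l1 x + l2 y = c passes through them. *)
Record corner V X Y (w a b : R * R) (l1 l2 c : int) : Prop := Corner {
  corner_half : exists i j : int, 2 * w.1 = i%:~R /\ 2 * w.2 = j%:~R;
  corner_integral_l : integral a;
  corner_integral_r : integral b;
  corner_fine_l : fine_region V X Y a;
  corner_fine_r : fine_region V X Y b;
  corner_tight_l : tight V X Y a;
  corner_tight_r : tight V X Y b;
  corner_coprime : coprimez l1 l2;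
  corner_eq_l : l1%:~R * a.1 + l2%:~R * a.2 = c%:~R;
  corner_eq_r : l1%:~R * b.1 + l2%:~R * b.2 = c%:~R;
  corner_lt : l1%:~R * w.1 + l2%:~R * w.2 < c%:~R;
  corner_cone : forall z, fine_region V X Y z -> exists x y : R,
    [/\ 0 <= x, 0 <= y, z.1 = w.1 + x * (a.1 - w.1) + y * (b.1 - w.1) &
        z.2 = w.2 + x * (a.2 - w.2) + y * (b.2 - w.2)];
  corner_cut : forall z, fine_region V X Y z -> integral z ->
    c%:~R <= l1%:~R * z.1 + l2%:~R * z.2;
  corner_primitive : exists f1 f2 : int,
    f1%:~R * (b.1 - a.1) + f2%:~R * (b.2 - a.2) = 1;
  corner_points : exists S : seq (int * int),
    [/\ uniq S, 2 * (c%:~R - (l1%:~R * w.1 + l2%:~R * w.2)) <= (size S)%:R + 2 &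
        forall s : int * int, s \in S -> half_hull V X Y (s.1%:~R : R, s.2%:~R)]}.

(** Everything is checked in the frame where w = (1/2, 1), a = (0, 1), b = (1, e + 1) and carried
    back. The cutting line is y - ex = 1 there. A lattice point of the region is not below it: for x
    <= 0 because of the first edge, for x >= 1 because of the second. *)
Lemma corner_exists V X Y (w w' w'' : R * R) (a1 b1 k1 a2 b2 k2 : int) :
  coprimez a1 b1 -> a1 * b2 - a2 * b1 != 0 ->
  (forall v, V v -> 2 * k1 <= a1 * X v + b1 * Y v) ->
  (forall v, V v -> 2 * k2 <= a2 * X v + b2 * Y v) ->
  a1%:~R * w.1 + b1%:~R * w.2 = k1%:~R + 1 ->
  a2%:~R * w.1 + b2%:~R * w.2 = k2%:~R + 1 ->
  fine_region V X Y w -> ~ integral w ->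
  fine_region V X Y w' -> w' <> w -> a1%:~R * w'.1 + b1%:~R * w'.2 = k1%:~R + 1 ->
  fine_region V X Y w'' -> w'' <> w -> a2%:~R * w''.1 + b2%:~R * w''.2 = k2%:~R + 1 ->
  exists a b l1 l2 c, corner V X Y w a b l1 l2 c.
Proof.
move=> h1 h2 h3 h4 h5 h6 h7 h8 h9 h10 h11 h12 h13 h14.
have := corner_frame h1 h2 h3 h4 h5 h6 h7 h8 h9 h10 h11 h12 h13 h14.
move=> [p [q [u0 [r [t [u1 [e /= [[hD e0] [hwx hwy] [hY hE] hv [fa fb]]]]]]]]].
pose X' v := p * X v + q * Y v + 2 * u0; pose Y' v := r * X v + t * Y v + 2 * u1.
have {}hY : forall v, V v -> 0 <= Y' v := hY.
have {}hE : forall v, V v -> - (2 * e) <= Y' v - 2 * e * X' v := hE.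
have {}hv : exists v, [/\ V v, X' v = 1 & Y' v = 0] := hv.
have {}fa : fine_region V X' Y' (0 : R, 1) := fa.
have {}fb : fine_region V X' Y' (1 : R, e%:~R + 1) := fb.
clear h1 h2 h3 h4 h5 h6 h8 h9 h10 h11 h12 h13 h14 w' w'' a1 b1 k1 a2 b2 k2.
have [D DD hDd] : exists2 D : int, D * D = 1 & p * t - q * r = D.
  by exists (p * t - q * r); rewrite // -expr2.
have D0 : D != 0 by apply/eqP => h; move: DD; rewrite h mul0r.
have hd0 : p * t - q * r != 0 by rewrite hDd.
have DDR : D%:~R * D%:~R = 1 :> R by rewrite -intrM DD.
have hDR : p%:~R * t%:~R - q%:~R * r%:~R = D%:~R :> R by rewrite -!intrM -intrB hDd.
have D0R : D%:~R != 0 :> R by rewrite intr_eq0.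
have eR : (0 : R) < e%:~R by rewrite ltr0z.
pose x z := p%:~R * z.1 + q%:~R * z.2 + u0%:~R : R.
pose y z := r%:~R * z.1 + t%:~R * z.2 + u1%:~R : R.
(* The inverse frame: the determinant D is 1 or -1, so the inverse matrix is D times the
   adjugate. *)
pose g i j : R * R := (D%:~R * (t%:~R * (i - u0%:~R) - q%:~R * (j - u1%:~R)),
                       D%:~R * (p%:~R * (j - u1%:~R) - r%:~R * (i - u0%:~R))).
have xg i j : x (g i j) = i.
  rewrite /x /g /=; set i' := i - _; set j' := j - _.
  have -> : p%:~R * (D%:~R * (t%:~R * i' - q%:~R * j')) + q%:~R * (D%:~R * (p%:~R * j' - r%:~R * i')) = D%:~R * (p%:~R * t%:~R - q%:~R * r%:~R) * i' by ring.
  by rewrite hDR DDR mul1r /i' subrK.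
have yg i j : y (g i j) = j.
  rewrite /y /g /=; set i' := i - _; set j' := j - _.
  have -> : r%:~R * (D%:~R * (t%:~R * i' - q%:~R * j')) + t%:~R * (D%:~R * (p%:~R * j' - r%:~R * i')) = D%:~R * (p%:~R * t%:~R - q%:~R * r%:~R) * j' by ring.
  by rewrite hDR DDR mul1r /j' subrK.
have gxy z : g (x z) (y z) = z.
  rewrite [RHS]surjective_pairing /g /x /y; congr pair.
    transitivity (D%:~R * (p%:~R * t%:~R - q%:~R * r%:~R) * z.1); first ring.
    by rewrite hDR DDR mul1r.
  transitivity (D%:~R * (p%:~R * t%:~R - q%:~R * r%:~R) * z.2); first ring.
  by rewrite hDR DDR mul1r.
pose gI (i j : int) : int * int := (D * (t * (i - u0) - q * (j - u1)),
                       D * (p * (j - u1) - r * (i - u0))).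
have gIE (i j : int) : g i%:~R j%:~R = ((gI i j).1%:~R, (gI i j).2%:~R).
  by rewrite /g /gI /= !(intrM, intrB).
have hdi : D * t * (D * p) - - (D * q) * - (D * r) != 0.
  rewrite (_ : _ - _ = D * D * (p * t - q * r)); last by ring.
  by rewrite DD mul1r.
have bX v : D * t * X' v + - (D * q) * Y' v + 2 * (D * (q * u1 - t * u0)) = X v.
  transitivity (D * (p * t - q * r) * X v); [rewrite /X' /Y'; ring|by rewrite hDd DD mul1r].
have bY v : - (D * r) * X' v + D * p * Y' v + 2 * (D * (r * u0 - p * u1)) = Y v.
  transitivity (D * (p * t - q * r) * Y v); [rewrite /X' /Y'; ring|by rewrite hDd DD mul1r].
have fg i j : fine_region V X' Y' (i, j) -> fine_region V X Y (g i j).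
  move=> /(@fine_frame V X' Y' _ (D * t) (- (D * q)) (D * (q * u1 - t * u0))
     (- (D * r)) (D * p) (D * (r * u0 - p * u1)) hdi).
  apply: fine_ext => //=; rewrite /g; congr pair; rewrite !(intrM, intrB, intrN); ring.
have hg i j : half_hull V X' Y' (i, j) -> half_hull V X Y (g i j).
  move=> /(@half_hull_frame V X' Y' (D * t) (- (D * q)) (D * (q * u1 - t * u0))
     (- (D * r)) (D * p) (D * (r * u0 - p * u1))).
  apply: half_hull_ext => //=; rewrite /g; congr pair; rewrite !(intrM, intrB, intrN); ring.
have fx z : fine_region V X Y z -> fine_region V X' Y' (x z, y z).
  exact: (@fine_frame V X Y z p q u0 r t u1 hd0).
have wg : w = g (1 / 2) 1 by rewrite -(gxy w) /x /y hwx hwy.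
pose a := g 0 1; pose b := g 1 (e%:~R + 1).
have lE z : (r - e * p)%:~R * z.1 + (t - e * q)%:~R * z.2 = y z - e%:~R * x z - u1%:~R + e%:~R * u0%:~R.
  by rewrite /y /x !(intrB, intrM); ring.
exists a, b, (r - e * p), (t - e * q), (1 - u1 + e * u0); split.
- exists (D * (t * (1 - 2 * u0) - q * (2 - 2 * u1))), (D * (p * (2 - 2 * u1) - r * (1 - 2 * u0))).
  by rewrite wg /g /= !(intrM, intrB); split; field.
- by rewrite /a -[0]/(0%:~R) -[1]/(1%:~R) gIE; do 2 eexists.
- by rewrite /b -[1]/(1%:~R) -intrD gIE; do 2 eexists.
- exact: fg.
- exact: fg.
- exists r, t, (- u1); split.
  + apply/negPn; rewrite negb_or !negbK; apply/negP => /andP[/eqP hr /eqP ht].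
    by move: hd0; rewrite hr ht !mulr0 subrr.
  + by move=> v /hY; rewrite /Y'; lia.
  + by have := yg 0 1; rewrite -/a /y intrN; lra.
- exists (r - 2 * e * p), (t - 2 * e * q), (2 * e * u0 - u1 - e); split.
  + apply/negPn; rewrite negb_or !negbK; apply/negP => /andP[/eqP hr /eqP ht].
    have : p * (t - 2 * e * q) - q * (r - 2 * e * p) != 0.
      by rewrite (_ : _ - _ = p * t - q * r) //; ring.
    by rewrite hr ht !mulr0 subrr.
  + by move=> v /hE; rewrite /Y' /X'; lia.
  + have := yg 1 (e%:~R + 1); have := xg 1 (e%:~R + 1).
    rewrite -/b => hx hy.
    have : y b - 2 * e%:~R * x b = 1 - e%:~R by rewrite hx hy; ring.
    rewrite /x /y !(intrB, intrM); lra.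
- apply/coprimezP; exists (- (D * q), D * p) => /=.
  transitivity (D * (p * t - q * r)); first ring.
  by rewrite hDd.
- by rewrite lE /a xg yg !(intrB, intrD, intrM); ring.
- by rewrite lE /b xg yg !(intrB, intrD, intrM); ring.
- rewrite lE [y w]hwy [x w]hwx !(intrB, intrD, intrM); lra.
- move=> z fz; have [z1 z2] := fine_cone hY hE (fx _ fz).
  have z10 : 0 <= (y z - 1) / e%:~R by apply: divr_ge0; [move: z1 => /=|]; lra.
  (* In the frame a - w = (-1/2, 0) and b - w = (1/2, e); these are the coordinates of z - w in that
     basis. *)
  exists ((y z - 1) / e%:~R - 2 * x z + 1), ((y z - 1) / e%:~R); split=> //.
  + have : 0 <= (y z - 1 - 2 * e%:~R * x z + e%:~R) / e%:~R.
      by apply: divr_ge0; [move: z2 => /=|]; lra.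
    by congr (0 <= _); field; rewrite gt_eqF.
  + rewrite wg /a /b -{1}(gxy z) /g /=; field; rewrite gt_eqF //.
  + rewrite wg /a /b -{1}(gxy z) /g /=; field; rewrite gt_eqF //.
- move=> z fz [i [j ez]].
  have [z1 z2] := fine_cone hY hE (fx _ fz).
  have ex : x z = (p * i + q * j + u0)%:~R by rewrite /x ez /= !(intrD, intrM).
  have ey : y z = (r * i + t * j + u1)%:~R by rewrite /y ez /= !(intrD, intrM).
  move: z1 z2; rewrite /= lE ex ey.
  move: (p * i + _ + _) (r * i + _ + _) => xi yi y1 y2.
  have {}y1 : 1 <= yi by rewrite -(ler_int R).
  have {}y2 : 1 - e <= yi - 2 * e * xi by rewrite -(ler_int R) !(intrB, intrM).
  suff : 1 <= yi - e * xi by rewrite -(ler_int R) !(intrB, intrD, intrM); lra.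
  have [xi0|xi1] : xi <= 0 \/ 1 <= xi by lia.
    by nia.
  have : e * 1 <= e * xi by apply: ler_wpM2l => //; lia.
  by lia.
(* The abscissa of the frame grows by exactly 1 from a to b. *)
- exists p, q; have := xg 0 1; have := xg 1 (e%:~R + 1).
  by rewrite -/a -/b /x; lra.
(* The columns x = 0 and x = 1 contribute 2m points in all, and e <= 2m + 1. *)
pose m := `|(e %/ 2)%Z|%N.
have hm : 2 * m%:Z <= e by rewrite /m; lia.
have [A [B hAB]] := two_columns e0 hm hY hE hv fa fb.
exists ([seq gI 0 (A + i%:Z) | i <- iota 0 m] ++ [seq gI 1 (B + i%:Z) | i <- iota 0 m]).
have gIinj i j i' j' : gI i j = gI i' j' -> i = i' /\ j = j'.
  move=> h; have h2 : g i%:~R j%:~R = g i'%:~R j'%:~R by rewrite !gIE h.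
  have hx := xg i%:~R j%:~R; have hy := yg i%:~R j%:~R.
  rewrite h2 xg in hx; rewrite h2 yg in hy.
  by split; apply/eqP; rewrite -(eqr_int R) ?hx ?hy.
split.
- rewrite cat_uniq; apply/and3P; split.
  + by rewrite map_inj_uniq ?iota_uniq // => i j /gIinj[_]; lia.
  + apply/hasPn => z /mapP[i _ ->]; apply/mapP => -[j _] /gIinj[]; lia.
  + by rewrite map_inj_uniq ?iota_uniq // => i j /gIinj[_]; lia.
- rewrite size_cat !size_map !size_iota lE [y w]hwy [x w]hwx.
  have : e <= m%:Z + m%:Z + 1 by rewrite /m; lia.
  rewrite -(ler_int R) !(intrB, intrD, intrM) natrD; lra.
- move=> z; rewrite mem_cat => /orP[] /mapP[i]; rewrite mem_iota add0n => /andP[_ im] ->.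
  + by rewrite -gIE; apply: hg; have [] := hAB i im; rewrite intrD.
  + by rewrite -gIE; apply: hg; have [] := hAB i im; rewrite intrD.
Qed.

End FineHull.

(** * Polygons given by finitely many half-planes *)

Section Plane.
Variable R : realType.
Implicit Types (u z d : R * R) (C : seq (R * R * R)).

Definition ev u z : R := u.1 * z.1 + u.2 * z.2.
Definition mv z (t : R) d := (z.1 + t * d.1, z.2 + t * d.2).
Definition cross u d : R := u.1 * d.2 - u.2 * d.1.
Definition feas C z := forall c, c \in C -> c.2 <= ev c.1 z.

Lemma ev_mv u z t d : ev u (mv z t d) = ev u z + t * ev u d.
Proof. rewrite /ev /mv /=; ring. Qed.

Lemma feas_cons c C z : feas (c :: C) z <-> c.2 <= ev c.1 z /\ feas C z.
Proof.
split=> [h|[h1 h2] c']; first split; first by apply: h; rewrite mem_head.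
  by move=> c' c'C; apply: h; rewrite inE c'C orbT.
by rewrite inE => /orP[/eqP ->|/h2].
Qed.

(** The exit time is the least time at which a constraint decreasing along d becomes tight; the
    induction compares the new constraint with the exit already found. *)
Lemma ray_exit C z d : feas C z -> (exists2 c, c \in C & ev c.1 d < 0) ->
  exists2 t, 0 <= t & feas C (mv z t d) /\
    exists c, [/\ c \in C, ev c.1 d < 0 & ev c.1 (mv z t d) = c.2].
Proof.
elim: C => [|c C IH] hz; first by case.
case/feas_cons: (hz) => hc hC [c' c'C hc'].
case: (pselect (exists2 c, c \in C & ev c.1 d < 0)) => [/(IH hC)|hn].
  move=> [t t0 [ht [b [bC bd bt]]]].
  case: (leP c.2 (ev c.1 (mv z t d))) => h.
    exists t => //; split; first exact/feas_cons.
    by exists b; split => //; rewrite inE bC orbT.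
  have cd : ev c.1 d < 0 by move: h; rewrite ev_mv; nra.
  pose t' := (ev c.1 z - c.2) / - ev c.1 d.
  have t'0 : 0 <= t' by apply: divr_ge0; lra.
  have t't : t' < t by rewrite /t' ltr_pdivrMr ?oppr_gt0 //; move: h; rewrite ev_mv; lra.
  have e : ev c.1 (mv z t' d) = c.2 by rewrite ev_mv /t'; field; rewrite lt_eqF.
  exists t' => //; split; last by exists c; rewrite mem_head.
  apply/feas_cons; split; first by rewrite e.
  move=> a aC; have := hC a aC; have := ht a aC; rewrite !ev_mv => h1 h2.
  have [ad|ad] := leP 0 (ev a.1 d); first by nra.
  by nra.
have hC' a : a \in C -> 0 <= ev a.1 d.
  by move=> aC; rewrite leNgt; apply/negP => ?; apply: hn; exists a.
have cd : ev c.1 d < 0.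
  by move: c'C; rewrite inE => /orP[/eqP <-//|/hC']; rewrite leNgt hc'.
pose t' := (ev c.1 z - c.2) / - ev c.1 d.
have t'0 : 0 <= t' by apply: divr_ge0; lra.
have e : ev c.1 (mv z t' d) = c.2 by rewrite ev_mv /t'; field; rewrite lt_eqF.
exists t' => //; split; last by exists c; rewrite mem_head.
apply/feas_cons; split; first by rewrite e.
move=> a aC; have := hC a aC; have := hC' a aC; rewrite !ev_mv; nra.
Qed.

Lemma feas_step C z d : feas C z ->
  (forall c, c \in C -> ev c.1 z = c.2 -> 0 <= ev c.1 d) ->
  exists2 t, 0 < t & feas C (mv z t d).
Proof.
elim: C => [|c C IH] hz hd; first by exists 1.
case/feas_cons: hz => hc hC.
have [|t t0 ht] := IH hC; first by move=> a aC; apply: hd; rewrite inE aC orbT.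
have ht' t' : 0 < t' -> t' <= t -> feas C (mv z t' d).
  move=> t'0 t't a aC; have := hC a aC; have := ht a aC; rewrite !ev_mv => h1 h2.
  have [ad|ad] := leP 0 (ev a.1 d); first by nra.
  by nra.
have [cd|cd] := leP 0 (ev c.1 d).
  by exists t => //; apply/feas_cons; split=> //; rewrite ev_mv; nra.
have hc' : c.2 < ev c.1 z.
  rewrite lt_neqAle hc andbT; apply/eqP => e.
  by have := hd c (mem_head _ _) (esym e); rewrite leNgt cd.
pose s := (ev c.1 z - c.2) / - ev c.1 d.
have s0 : 0 < s by apply: divr_gt0; lra.
exists (Num.min t s); first by rewrite lt_min t0.
apply/feas_cons; split.
  have : Num.min t s <= s by rewrite ge_min lexx orbT.
  by rewrite {2}/s ler_pdivlMr ?oppr_gt0 // ev_mv; lra.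
by apply: ht'; rewrite ?lt_min ?t0 // ge_min lexx.
Qed.

(** The basic feasible solutions of linear programming, that is, the vertices of the region cut out
    by C. *)
Definition node C z := feas C z /\ exists c1 c2,
  [/\ c1 \in C, c2 \in C, cross c1.1 c2.1 != 0, ev c1.1 z = c1.2 & ev c2.1 z = c2.2].

Lemma convex_between (K : R * R -> Prop) z d (s t : R) : convex_pred K ->
  0 <= s -> 0 <= t -> K (mv z s d) -> K (mv z (- t) d) -> K z.
Proof.
move=> cK s0 t0 K1 K2; have [e|e] := eqVneq (s + t) 0.
  move: K1; have -> : s = 0 by lra.
  by rewrite /mv !mul0r !addr0 -surjective_pairing.
have st0 : 0 < s + t by rewrite lt_neqAle eq_sym e; lra.
have hl : 0 <= t / (s + t) <= 1.
  by apply/andP; split; [apply: divr_ge0; lra|rewrite ler_pdivrMr //; lra].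
have := cK _ _ _ hl K1 K2; congr K; rewrite [RHS]surjective_pairing /mv /=.
by congr pair; field.
Qed.

(** The hypothesis on directions expresses boundedness. Two opposite rays put a point between two
    points on tight lines, and rays along such a line put each of those between two nodes. *)
Lemma feas_hull C (K : R * R -> Prop) : convex_pred K ->
  (forall d, d <> (0, 0) -> exists2 c, c \in C & ev c.1 d < 0) ->
  (forall z, node C z -> K z) -> forall z, feas C z -> K z.
Proof.
move=> cK hb hK.
have opp_dir d : d <> (0, 0) -> (- d.1, - d.2) <> (0, 0).
  case: d => d1 d2 /= h [/eqP + /eqP]; rewrite !oppr_eq0 => /eqP e1 /eqP e2.
  by apply: h; rewrite e1 e2.
have mvN z t d : mv z t (- d.1, - d.2) = mv z (- t) d by rewrite /mv /=; congr pair; ring.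
have evN u d : ev u (- d.1, - d.2) = - ev u d by rewrite /ev /=; ring.
have K1 z c : feas C z -> c \in C -> c.1 <> (0, 0) -> ev c.1 z = c.2 -> K z.
  move=> hz cC c0 cz; pose d := (- c.1.2, c.1.1).
  have d0 : d <> (0, 0).
    move=> [/eqP + h]; rewrite oppr_eq0 => /eqP h'; apply: c0.
    by rewrite [LHS]surjective_pairing h h'.
  have cd : ev c.1 d = 0 by rewrite /ev /d /=; ring.
  have [t t0 [ht [b [bC bd bt]]]] := ray_exit hz (hb d d0).
  have [s s0 [hs [a [aC ad as_]]]] := ray_exit hz (hb _ (opp_dir d d0)).
  have crossE b' : cross c.1 b'.1 = ev (b' : R * R * R).1 d by rewrite /cross /ev /d /=; ring.
  apply: (@convex_between K z d t s cK t0 s0).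
    apply: hK; split=> //; exists c, b; split=> //.
      by rewrite crossE lt_eqF.
    by rewrite ev_mv cd mulr0 addr0.
  rewrite -mvN; apply: hK; split=> //; exists c, a; split=> //.
    by rewrite crossE; move: ad; rewrite evN oppr_lt0 => /gt_eqF ->.
  by rewrite ev_mv evN cd oppr0 mulr0 addr0.
move=> z hz; pose d : R * R := (1, 0).
have d0 : d <> (0, 0) by case=> /eqP; rewrite oner_eq0.
have [t t0 [ht [b [bC bd bt]]]] := ray_exit hz (hb d d0).
have [s s0 [hs [a [aC ad as_]]]] := ray_exit hz (hb _ (opp_dir d d0)).
have nz u d' : ev u d' < 0 -> u <> (0, 0).
  by move=> h e; move: h; rewrite e /ev /= !mul0r addr0 ltxx.
apply: (@convex_between K z d t s cK t0 s0); first exact: K1 ht bC (nz _ _ bd) bt.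
by rewrite -mvN; apply: K1 hs aC (nz _ _ ad) as_.
Qed.

Lemma solve_cross u d (p q : R) : cross u d != 0 ->
  exists x, ev u x = p /\ ev d x = q.
Proof.
move=> h; exists ((p * d.2 - q * u.2) / cross u d, (q * u.1 - p * d.1) / cross u d).
move: h; rewrite /ev /cross /= => h.
by split; field.
Qed.

(* The two edges at w are found by leaving the tangent cone at w from an
   interior direction along the two opposite directions that are not in it. *)
Lemma node_edges C w z0 : node C w -> (forall c, c \in C -> c.2 < ev c.1 z0) ->
  exists c1 c2 w1 w2, [/\ c1 \in C, c2 \in C, cross c1.1 c2.1 != 0,
    [/\ ev c1.1 w = c1.2, ev c1.1 w1 = c1.2, feas C w1 & w1 <> w] &
    [/\ ev c2.1 w = c2.2, ev c2.1 w2 = c2.2, feas C w2 & w2 <> w]].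
Proof.
move=> [hw [n [n' [nC n'C hnn nw n'w]]]] hz0.
have [q [nq n'q]] := solve_cross 1 (-1) hnn.
pose D := [seq (c.1, 0) : R * R * R | c <- C & ev c.1 w == c.2].
pose x0 := (z0.1 - w.1, z0.2 - w.2).
have evx0 u : ev u x0 = ev u z0 - ev u w by rewrite /ev /x0 /=; ring.
have hx0 c : c \in C -> ev c.1 w = c.2 -> 0 < ev c.1 x0.
  by move=> cC cw; rewrite evx0 cw; have := hz0 c cC; lra.
have DP a : a \in D -> exists2 c, c \in C & ev c.1 w = c.2 /\ a = (c.1, 0).
  by move=> /mapP[c]; rewrite mem_filter => /andP[/eqP cw cC] ->; exists c.
have memD c : c \in C -> ev c.1 w = c.2 -> (c.1, 0) \in D.
  by move=> cC cw; apply/mapP; exists c => //; rewrite mem_filter cw eqxx.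
have fx0 : feas D x0.
  by move=> _ /DP[b bC [bw ->]] /=; apply: ltW; apply: hx0.
have step x : feas D x -> x <> (0, 0) -> exists y, [/\ feas C y, y <> w &
    forall c, ev c.1 x = 0 -> ev c.1 w = c.2 -> ev (c : R * R * R).1 y = c.2].
  move=> hx xn; have [|t t0 ht] := @feas_step C w x hw.
    by move=> c cC cw; have := hx _ (memD c cC cw).
  exists (mv w t x); split=> //; last by move=> c cx cw; rewrite ev_mv cx mulr0 addr0.
  rewrite /mv [w in RHS]surjective_pairing => -[e1 e2]; apply: xn.
  rewrite [LHS]surjective_pairing; congr pair; apply/eqP.
    by rewrite -(mulrI_eq0 _ (lregP (lt0r_neq0 t0))); apply/eqP; lra.
  by rewrite -(mulrI_eq0 _ (lregP (lt0r_neq0 t0))); apply/eqP; lra.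
have evN u d : ev u (- d.1, - d.2) = - ev u d by rewrite /ev /=; ring.
have [|t t0 [ht [a [aD aq at_]]]] := @ray_exit D x0 q fx0.
  by exists (n'.1, 0); [exact: memD|rewrite n'q oppr_lt0].
have [|s s0 [hs [b [bD bq bt]]]] := @ray_exit D x0 (- q.1, - q.2) fx0.
  by exists (n.1, 0); [exact: memD|rewrite evN nq oppr_lt0].
case/DP: aD aq at_ => c1 c1C [c1w ->] /= c1q c1t.
case/DP: bD bq bt => c2 c2C [c2w ->] /= c2q c2t.
rewrite evN oppr_lt0 in c2q.
have [|y1 [fy1 y1w hy1]] := step _ ht.
  move=> e; have := ev_mv n.1 x0 t q; rewrite e nq mulr1.
  have := hx0 n nC nw; rewrite /ev /=; lra.
have [|y2 [fy2 y2w hy2]] := step _ hs.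
  move=> e; have := ev_mv n'.1 x0 s (- q.1, - q.2); rewrite e evN n'q opprK mulr1.
  have := hx0 n' n'C n'w; rewrite /ev /=; lra.
exists c1, c2, y1, y2; split=> //; try by split => //; [apply: hy1|apply: hy2].
(* Both normals are positive on [x0] but take opposite signs on q, so they cannot be parallel. *)
- apply/eqP => hc.
  have h1 := hx0 c1 c1C c1w; have h2 := hx0 c2 c2C c2w.
  have : ev c1.1 x0 * ev c2.1 q - ev c2.1 x0 * ev c1.1 q = cross c1.1 c2.1 * cross x0 q.
    rewrite /ev /cross; ring.
  rewrite hc mul0r; nra.
- by split => //; apply: hy1.
- by split => //; apply: hy2.
Qed.

Lemma seq_argmin (A : eqType) (s : seq A) (f : A -> R) : s != [::] ->
  exists2 a, a \in s & forall b, b \in s -> f a <= f b.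
Proof.
elim: s => // x s IH _; have [->|/IH[a aS ha]] := eqVneq s [::].
  by exists x; rewrite ?mem_head // => b; rewrite inE => /eqP ->.
case: (leP (f x) (f a)) => h.
  exists x; rewrite ?mem_head // => b; rewrite inE => /orP[/eqP -> //|/ha].
  exact: le_trans.
exists a; first by rewrite inE aS orbT.
by move=> b; rewrite inE => /orP[/eqP ->|/ha //]; exact: ltW.
Qed.

(* Induction on W: if u is positive on W' but not on w0, either W' lies
   strictly on one side of the line of w0, or two points of W' on both sides
   have a positive combination that is a negative multiple of w0. *)
Lemma gordan (W : seq (R * R)) :
  (exists u, forall w, w \in W -> 0 < ev u w) \/
  (forall K : R * R -> Prop, convex_pred K -> (forall w, w \in W -> K w) -> K (0, 0)).
Proof.
have three (K : R * R -> Prop) w1 w2 w0 (a b c : R) : convex_pred K ->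
    K w1 -> K w2 -> K w0 -> 0 <= a -> 0 <= b -> 0 <= c -> 0 < a + b + c ->
    a * w1.1 + b * w2.1 + c * w0.1 = 0 -> a * w1.2 + b * w2.2 + c * w0.2 = 0 ->
    K (0, 0).
  move=> cK k1 k2 k0 a0 b0 c0 abc e1 e2.
  have [ab|ab] := eqVneq (a + b) 0.
    have c1 : 0 < c by lra.
    have [a1 b1] : a = 0 /\ b = 0 by lra.
    move: e1 e2 k0; rewrite a1 b1 !mul0r !add0r => /eqP + /eqP.
    rewrite !mulf_eq0 gt_eqF //= => /eqP e1 /eqP e2.
    by rewrite [w0]surjective_pairing e1 e2.
  have ab0 : 0 < a + b by rewrite lt_neqAle eq_sym ab; lra.
  have hl : 0 <= a / (a + b) <= 1.
    by apply/andP; split; [apply: divr_ge0; lra|rewrite ler_pdivrMr //; lra].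
  have hm : 0 <= (a + b) / (a + b + c) <= 1.
    by apply/andP; split; [apply: divr_ge0; lra|rewrite ler_pdivrMr //; lra].
  have := cK _ _ _ hm (cK _ _ _ hl k1 k2) k0; congr K => /=.
  have abc0 : a + b + c != 0 by rewrite gt_eqF.
  congr pair.
    by rewrite -[RHS](mul0r (a + b + c)^-1) -e1; field; rewrite abc0.
  by rewrite -[RHS](mul0r (a + b + c)^-1) -e2; field; rewrite abc0.
elim: W => [|w0 W IH]; first by left; exists (0, 0).
case: IH => [[u hu]|h]; last first.
  by right=> K cK hK; apply: h => // w wW; apply: hK; rewrite inE wW orbT.
have [uw0|uw0] := ltP 0 (ev u w0).
  by left; exists u => w; rewrite inE => /orP[/eqP ->|/hu].
have [w00|w00] := eqVneq w0 (0, 0).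
  by right=> K _ hK; have := hK w0; rewrite mem_head w00; apply.
have n0 : 0 < ev w0 w0.
  rewrite /ev lt_neqAle addr_ge0 ?andbT -?expr2 ?sqr_ge0 // eq_sym.
  rewrite paddr_eq0 ?sqr_ge0 // !sqrf_eq0; apply/negP => /andP[/eqP e1 /eqP e2].
  by move: w00; rewrite [w0]surjective_pairing e1 e2 eqxx.
(* If W lies strictly on one side of the line of [w0], tilt the normal n of that line slightly
   towards [w0]. Half of the step found by [feas_step] keeps the inequalities on W strict. *)
have sep (sg : R) : (forall w, w \in W -> 0 < sg * cross w0 w) ->
    exists u, forall w, w \in w0 :: W -> 0 < ev u w.
  move=> hs; pose n : R * R := (- (sg * w0.2), sg * w0.1).
  pose C := [seq ((w, 0) : R * R * R) | w <- W].
  have evC u' d : ev u' d = ev d u' by rewrite /ev; ring.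
  have evmv n' t d w : ev (mv n' t d) w = ev n' w + t * ev d w by rewrite evC ev_mv !(evC w).
  have nE w : ev n w = sg * cross w0 w by rewrite /n /ev /cross /=; ring.
  pose C' := [seq ((w, 0) : R * R * R) | w <- w0 :: W].
  have [||t t0 ht] := @feas_step C' n w0.
  - move=> c /mapP[w + ->] /=; rewrite inE evC => /orP[/eqP ->|/hs].
      by rewrite /n /ev /=; lra.
    by rewrite nE => /ltW.
  - move=> c /mapP[w + ->] /=; rewrite inE => /orP[/eqP -> _|/hs h].
      exact: ltW.
    by rewrite evC nE => e; move: h; rewrite e ltxx.
  have ht2 w : w \in W -> 0 < ev (mv n (t / 2) w0) w.
    move=> wW; have := hs w wW; rewrite -nE evC => hw.
    have /ht : (w, 0) \in C' by apply/mapP; exists w; rewrite // inE wW orbT.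
    rewrite /= evC !evmv; move: hw; rewrite evC; lra.
  exists (mv n (t / 2) w0) => w; rewrite inE => /orP[/eqP ->|/ht2 //].
  rewrite evmv nE (_ : cross w0 w0 = 0) ?mulr0 ?add0r.
    by apply: mulr_gt0 => //; lra.
  by rewrite /cross; ring.
case: (pselect (forall w, w \in W -> 0 < cross w0 w)) => [hp|].
  by left; apply: (sep 1) => w /hp; rewrite mul1r.
move=> /existsNP[w1] /not_implyP[w1W] /negP; rewrite -leNgt => s1.
case: (pselect (forall w, w \in W -> cross w0 w < 0)) => [hp|].
  by left; apply: (sep (-1)) => w /hp; rewrite mulN1r oppr_gt0.
move=> /existsNP[w2] /not_implyP[w2W] /negP; rewrite -leNgt => s2.
right=> K cK hK.
have k0 : K w0 by apply: hK; rewrite mem_head.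
have k1 : K w1 by apply: hK; rewrite inE w1W orbT.
have k2 : K w2 by apply: hK; rewrite inE w2W orbT.
have u1 := hu _ w1W; have u2 := hu _ w2W.
have [e1|e1] := eqVneq (cross w0 w1) 0.
  have key : ev w0 w0 * ev u w1 = ev w0 w1 * ev u w0 + cross w0 w1 * cross w0 u.
    by rewrite /ev /cross; ring.
  rewrite e1 mul0r addr0 in key.
  have h1 : ev w0 w1 < 0 by nra.
  apply: (three K w1 w1 w0 (ev w0 w0) 0 (- ev w0 w1)) => //; try lra.
    have : ev w0 w0 * w1.1 - ev w0 w1 * w0.1 = - w0.2 * cross w0 w1.
      by rewrite /ev /cross; ring.
    by rewrite e1; lra.
  have : ev w0 w0 * w1.2 - ev w0 w1 * w0.2 = w0.1 * cross w0 w1.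
    by rewrite /ev /cross; ring.
  by rewrite e1; lra.
pose a := cross w0 w2; pose b := - cross w0 w1.
have b0 : 0 < b by rewrite /b oppr_gt0 lt_neqAle e1.
have a0 : 0 <= a by [].
pose zz := (a * w1.1 + b * w2.1, a * w1.2 + b * w2.2).
have uz : 0 < ev u zz.
  rewrite (_ : ev u zz = a * ev u w1 + b * ev u w2); last by rewrite /ev /zz /=; ring.
  by apply: ltr_wpDl; [apply: mulr_ge0 => //; apply: ltW|apply: mulr_gt0].
have cz : cross w0 zz = 0 by rewrite /cross /zz /a /b /cross /=; ring.
have key : ev w0 w0 * ev u zz = ev w0 zz * ev u w0 + cross w0 zz * cross w0 u.
  by rewrite /ev /cross; ring.
rewrite cz mul0r addr0 in key.
have h1 : ev w0 zz < 0 by nra.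
apply: (three K w1 w2 w0 (ev w0 w0 * a) (ev w0 w0 * b) (- ev w0 zz)) => //.
- by apply: mulr_ge0 => //; lra.
- by apply: mulr_ge0; lra.
- lra.
- have : 0 <= ev w0 w0 * a by apply: mulr_ge0 => //; lra.
  have : 0 <= ev w0 w0 * b by apply: mulr_ge0; lra.
  lra.
- have : ev w0 w0 * zz.1 - ev w0 zz * w0.1 = - w0.2 * cross w0 zz.
    by rewrite /ev /cross; ring.
  rewrite cz /zz /=; move: (ev w0 _) => k; lra.
- have : ev w0 w0 * zz.2 - ev w0 zz * w0.2 = w0.1 * cross w0 zz.
    by rewrite /ev /cross; ring.
  rewrite cz /zz /=; move: (ev w0 _) => k; lra.
Qed.
End Plane.

(** * Finiteness of the defining family *)

Section FiniteFine.
Variable R : realType.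
Implicit Types (Vs : seq (int * int)) (u z : R * R).

Definition toR (v : int * int) : R * R := (v.1%:~R, v.2%:~R).

(** The functionals g1 and g2 take opposite signs on q, so the line through n in direction q leaves
    the dual cone of gs on both sides. The two exit points lie on boundary rays, and n is a convex
    combination of them. *)
Lemma cone_split (gs : seq (R * R)) (g1 g2 n : R * R) :
  g1 \in gs -> g2 \in gs -> cross g1 g2 != 0 ->
  (forall g, g \in gs -> 0 <= ev g n) ->
  exists n1 n2, [/\ n = (n1.1 + n2.1, n1.2 + n2.2),
    (forall g, g \in gs -> 0 <= ev g n1) /\ (forall g, g \in gs -> 0 <= ev g n2),
    exists g, [/\ g \in gs, g <> (0, 0) & ev g n1 = 0] &
    exists g, [/\ g \in gs, g <> (0, 0) & ev g n2 = 0]].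
Proof.
move=> h1 h2 h12 hn.
have [q [q1 q2]] := solve_cross 1 (-1) h12.
pose C := [seq ((g, 0) : R * R * R) | g <- gs].
have fn : feas C n by move=> c /mapP[g + ->] /=; exact: hn.
have mC g : g \in gs -> (g, 0) \in C by move=> gg; apply/mapP; exists g.
have evN u d : ev u (- d.1, - d.2) = - ev u d :> R by rewrite /ev /=; ring.
have [|t t0 [ht [a [aC aq at_]]]] := @ray_exit _ C n q fn.
  by exists (g2, 0); [exact: mC|rewrite q2 oppr_lt0].
have [|s s0 [hs [b [bC bq bt]]]] := @ray_exit _ C n (- q.1, - q.2) fn.
  by exists (g1, 0); [exact: mC|rewrite evN q1 oppr_lt0].
case/mapP: aC aq at_ => ga gaC -> /= gaq gat.
case/mapP: bC bq bt => gb gbC -> /= gbq gbt.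
have nz u d' : ev u d' < 0 -> u <> (0, 0) :> R * R.
  by move=> h e; move: h; rewrite e /ev /= !mul0r addr0 ltxx.
set m1 := mv n t q in ht gat; set m2 := mv n s _ in hs gbt.
have sc u (k : R) m : ev u (k * m.1, k * m.2) = k * ev u m by rewrite /ev /=; ring.
have [x [y [x0 y0 e1 e2]]] : exists x y : R, [/\ 0 <= x, 0 <= y,
    n.1 = x * m1.1 + y * m2.1 & n.2 = x * m1.2 + y * m2.2].
  have [e|e] := eqVneq (s + t) 0.
    have [s00 t00] : s = 0 /\ t = 0 by lra.
    exists 2^-1, 2^-1; rewrite /m1 /m2 /mv /= s00 t00 !mul0r !addr0; split; lra.
  have st0 : 0 < s + t by rewrite lt_neqAle eq_sym e; lra.
  exists (s / (s + t)), (t / (s + t)); rewrite /m1 /m2 /mv /=.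
  by split; try (by apply: divr_ge0; lra); field.
exists (x * m1.1, x * m1.2), (y * m2.1, y * m2.2); split.
- by rewrite [LHS]surjective_pairing e1 e2.
- split=> g gg; rewrite sc; apply: mulr_ge0 => //.
    by have := ht _ (mC g gg).
  by have := hs _ (mC g gg).
- by exists ga; rewrite sc gat mulr0; split=> //; exact: nz gaq.
- by exists gb; rewrite sc gbt mulr0; split=> //; exact: nz gbq.
Qed.

Lemma half_floor (M : int) : 2 * (M %/ 2)%Z <= M <= 2 * (M %/ 2)%Z + 1.
Proof. lia. Qed.

Definition noncollinear Vs := exists v0 v1 v2 : int * int,
  [/\ v0 \in Vs, v1 \in Vs, v2 \in Vs &
      (v1.1 - v0.1) * (v2.2 - v0.2) - (v1.2 - v0.2) * (v2.1 - v0.1) != 0].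

(* Every functional minimised at v is a nonnegative combination of two normals
   of edges at v, and each of these is an integral covector of size at most B
   whose value on z exceeds its minimum by at least 1/2. *)
Lemma fine_margin Vs (B : int) z : noncollinear Vs ->
  (forall v v', v \in Vs -> v' \in Vs -> `|v'.1 - v.1| + `|v'.2 - v.2| <= B) ->
  (forall a b k : int, (a != 0) || (b != 0) -> `|a| <= B -> `|b| <= B ->
    (forall v, v \in Vs -> 2 * k <= a * v.1 + b * v.2) ->
    k%:~R + 1 <= a%:~R * z.1 + b%:~R * z.2) ->
  forall (n : R * R) v, v \in Vs ->
    (forall v', v' \in Vs -> ev n (toR v) <= ev n (toR v')) ->
    `|n.1| + `|n.2| <= 2 * B%:~R * (ev n z - ev n (toR v) / 2).
Proof.
move=> [v0 [v1 [v2 [v0V v1V v2V hdet]]]] hB hz n v vV hn.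
pose g v' : R * R := (v'.1%:~R - v.1%:~R, v'.2%:~R - v.2%:~R).
have gE u v' : ev (g v') u = ev u (toR v') - ev u (toR v).
  by rewrite /ev /g /toR /=; ring.
have B0 : 0 <= B.
  by apply: le_trans (hB _ _ v0V v0V); rewrite addr_ge0.
have [va [vb [vaV vbV hab]]] : exists va vb, [/\ va \in Vs, vb \in Vs & cross (g va) (g vb) != 0].
  apply: contrapT => hnn.
  have c0 va vb : va \in Vs -> vb \in Vs -> cross (g va) (g vb) = 0.
    move=> ha hb; apply/eqP; apply/negPn/negP => h; apply: hnn.
    by exists va, vb; rewrite h.
  move: hdet; rewrite -(intr_eq0 R) !(intrB, intrM) => /eqP; apply.
  have := c0 _ _ v0V v1V; have := c0 _ _ v1V v2V; have := c0 _ _ v2V v0V.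
  rewrite /cross /g /=; lra.
have gin v' : v' \in Vs -> g v' \in map g Vs by move=> h; apply/mapP; exists v'.
have [|n1 [n2 [nE [c1 c2] [t1 [t1V t10 t1n]] [t2 [t2V t20 t2n]]]]] :=
    cone_split (gin _ vaV) (gin _ vbV) hab (n := n).
  by move=> _ /mapP[v' v'V ->]; rewrite gE subr_ge0; exact: hn.
have one m t : (forall g', g' \in map g Vs -> 0 <= ev g' m) -> t \in map g Vs ->
    t <> (0, 0) -> ev t m = 0 ->
    `|m.1| + `|m.2| <= 2 * B%:~R * (ev m z - ev m (toR v) / 2).
  move=> hm /mapP[v' v'V ->] gn gm.
  pose G1 := v'.1 - v.1; pose G2 := v'.2 - v.2.
  have gG : g v' = (G1%:~R, G2%:~R) by rewrite /g /G1 /G2 !intrB.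
  (* A vector orthogonal to (G1, G2) is a multiple of its rotation by a right angle; l is the scalar
     product with that rotation divided by the squared length. *)
  have [l [l1 l2]] : exists l : R, m.1 = - l * G2%:~R /\ m.2 = l * G1%:~R.
    move: gn gm; rewrite gG /ev /= => gn gm.
    have nn : (G1%:~R : R) ^+ 2 + G2%:~R ^+ 2 != 0.
      rewrite paddr_eq0 ?sqr_ge0 // !sqrf_eq0; apply/negP => /andP[/eqP h1 /eqP h2].
      by apply: gn; rewrite h1 h2.
    exists ((G1%:~R * m.2 - G2%:~R * m.1) / (G1%:~R ^+ 2 + G2%:~R ^+ 2)); split.
      transitivity (((G1%:~R * m.1 + G2%:~R * m.2) * G1%:~R - (G1%:~R * m.2 - G2%:~R * m.1) * G2%:~R) / (G1%:~R ^+ 2 + G2%:~R ^+ 2)); first by field.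
      by rewrite gm; field.
    transitivity (((G1%:~R * m.1 + G2%:~R * m.2) * G2%:~R + (G1%:~R * m.2 - G2%:~R * m.1) * G1%:~R) / (G1%:~R ^+ 2 + G2%:~R ^+ 2)); first by field.
    by rewrite gm; field.
  have hG : `|G1| + `|G2| <= B by exact: hB.
  have hGR : `|G1%:~R| + `|G2%:~R| <= B%:~R :> R by rewrite -!intr_norm -intrD ler_int.
  have [l0|l0] := eqVneq l 0.
    by rewrite /ev /toR l1 l2 l0 oppr0 !mul0r normr0 /= !addr0 !mul0r subrr mulr0.
  have G0 : (G1 != 0) || (G2 != 0).
    apply/negPn; rewrite negb_or !negbK; apply/negP => /andP[/eqP h1 /eqP h2].
    by apply: gn; rewrite gG h1 h2.
  pose sg : int := if 0 < l then 1 else -1.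
  have lsg : l = `|l| * sg%:~R.
    rewrite /sg; case: ltP => h; first by rewrite gtr0_norm // mulr1.
    by rewrite ler0_norm // intrN mulr1z mulrN1 opprK.
  have nl : 0 < `|l| by rewrite normr_gt0.
  pose a := - sg * G2; pose b := sg * G1.
  have e1 : m.1 = `|l| * a%:~R by rewrite l1 lsg /a intrM intrN normrM normr_id; rewrite (_ : `|sg%:~R| = 1 :> R); [ring|rewrite /sg; case: ltP; rewrite ?intrN ?normrN normr1].
  have e2 : m.2 = `|l| * b%:~R by rewrite l2 lsg /b intrM normrM normr_id; rewrite (_ : `|sg%:~R| = 1 :> R); [ring|rewrite /sg; case: ltP; rewrite ?intrN ?normrN normr1].
  have sg1 x : `|sg * x| = `|x| :> int by rewrite normrM (_ : `|sg| = 1) ?mul1r //; rewrite /sg; case: ltP.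
  have intrE2 (a1 a2 a3 a4 : int) : (a1 * a2 + a3 * a4)%:~R = a1%:~R * a2%:~R + a3%:~R * a4%:~R :> R.
    by rewrite intrD !intrM.
  (* M is twice the minimum of (a, b). As M <= 2k + 1, the bound k + 1 at z exceeds M/2 by at least
     1/2. *)
  pose M := a * v.1 + b * v.2; pose k := (M %/ 2)%Z.
  have hM v'' : v'' \in Vs -> M <= a * v''.1 + b * v''.2.
    move=> v''V; rewrite -(ler_int R) /M !intrE2 -(ler_pM2l nl).
    by have := hm _ (gin _ v''V); rewrite gE subr_ge0 /ev /toR /= e1 e2; lra.
  have /andP[hk1 hk2] : 2 * k <= M <= 2 * k + 1 := half_floor M.
  have /hz : (a != 0) || (b != 0).
    by rewrite -[a == 0]normr_eq0 -[b == 0]normr_eq0 /a /b mulNr normrN !sg1 !normr_eq0 orbC.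
  have ha : `|a| <= B by rewrite /a mulNr normrN sg1; apply: le_trans hG; rewrite lerDr.
  have hb : `|b| <= B by rewrite /b sg1; apply: le_trans hG; rewrite lerDl.
  move=> /(_ k ha hb) hz'.
  have {}hz' : k%:~R + 1 <= a%:~R * z.1 + b%:~R * z.2.
    by apply: hz' => v'' /hM; apply: le_trans.
  have hMR : (M%:~R : R) <= 2 * k%:~R + 1.
    by move: hk2; rewrite -(ler_int R) [(2 * k + 1)%:~R]intrD [(2 * k)%:~R]intrM.
  have MR : M%:~R = a%:~R * v.1%:~R + b%:~R * v.2%:~R :> R by rewrite /M intrE2.
  have -> : ev m z - ev m (toR v) / 2 = `|l| * (a%:~R * z.1 + b%:~R * z.2 - M%:~R / 2).
    by rewrite /ev /toR /= e1 e2 MR; field.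
  have -> : `|m.1| + `|m.2| = `|l| * (`|G1%:~R| + `|G2%:~R|).
    by rewrite l1 l2 mulNr normrN !normrM; ring.
  have BR : (0 : R) <= B%:~R by rewrite ler0z.
  rewrite mulrCA; apply: ler_wpM2l; first exact: ltW.
  have : 2 * B%:~R * (1 / 2) <= 2 * B%:~R * (a%:~R * z.1 + b%:~R * z.2 - M%:~R / 2).
    by apply: ler_wpM2l; lra.
  lra.
have h1 := one n1 t1 c1 t1V t10 t1n; have h2 := one n2 t2 c2 t2V t20 t2n.
have evD u : ev n u = ev n1 u + ev n2 u by rewrite nE /ev /=; ring.
rewrite !evD nE /=.
have := ler_normD n1.1 n2.1; have := ler_normD n1.2 n2.2; lra.
Qed.
End FiniteFine.

Section FiniteRepresentation.
Variable R : realType.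
Implicit Types (Vs : seq (int * int)) (u z : R * R).

Definition mem_in (A : eqType) (s : seq A) (a : A) : Prop := a \in s.
Definition fineV Vs z := fine_region (mem_in Vs) fst snd z.

Lemma seq_bound (A : eqType) (s : seq A) (f : A -> int) :
  exists2 B : int, 0 < B & forall a, a \in s -> f a <= B.
Proof.
elim: s => [|x s [B B0 hB]]; first by exists 1.
exists (Num.max B (f x)); first by rewrite lt_max B0.
move=> a; rewrite inE => /orP[/eqP ->|/hB h]; rewrite le_max ?lexx ?orbT //.
by rewrite h.
Qed.

Lemma int_range (B : int) : exists s : seq int, forall a : int, `|a| <= B -> a \in s.
Proof.
exists ([seq i%:Z | i <- iota 0 (absz B).+1] ++ [seq - i%:Z | i <- iota 0 (absz B).+1]) => a ha.
rewrite mem_cat; have [a0|a0] := leP 0 a; apply/orP; [left|right];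
  by apply/mapP; exists `|a|%N; rewrite ?mem_iota; lia.
Qed.

(** Covectors with entries of size at most 2B suffice: any other has l1-norm at least 2B, and
    [fine_margin] gives its inequality. By [fine_primitive] only coprime pairs among them are kept,
    as the unimodular frame at a corner requires. The functionals x, -x, y, -y are in the list and
    make the region bounded. The margin stays in the conclusion because it also locates interior
    points. *)
Lemma fine_finite Vs : noncollinear Vs -> exists2 B : int, 0 < B & exists C,
  [/\ forall z, feas C z <-> fineV Vs z,
      forall c, c \in C -> exists a b k : int,
        [/\ coprimez a b, forall v, v \in Vs -> 2 * k <= a * v.1 + b * v.2 &
            c = ((a%:~R, b%:~R), k%:~R + 1)],
      forall d, d <> (0, 0) -> exists2 c, c \in C & ev c.1 d < 0 &
      forall z, fineV Vs z -> forall (n : R * R) v, v \in Vs ->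
        (forall v', v' \in Vs -> ev n (toR R v) <= ev n (toR R v')) ->
        `|n.1| + `|n.2| <= 2 * B%:~R * (ev n z - ev n (toR R v) / 2)].
Proof.
move=> hnc.
have V0 : Vs != [::] by case: hnc => v0 [_ [_ [+ _ _ _]]]; case: (Vs).
have [B B0 hB'] := seq_bound (allpairs pair Vs Vs)
  (fun p => `|p.2.1 - p.1.1| + `|p.2.2 - p.1.2|).
have hB v v' : v \in Vs -> v' \in Vs -> `|v'.1 - v.1| + `|v'.2 - v.2| <= B.
  by move=> hv hv'; apply: (hB' (v, v')); apply/allpairsP; exists (v, v').
(* The greatest admissible k: half of the minimum over the doubled points, rounded down. *)
have /choice[kf hkf] : forall ab : int * int, exists k : int,
    (forall v, v \in Vs -> 2 * k <= ab.1 * v.1 + ab.2 * v.2) /\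
    exists2 v, v \in Vs & ab.1 * v.1 + ab.2 * v.2 <= 2 * k + 1.
  move=> ab.
  have [v vV hv] := @seq_argmin R _ Vs (fun v => (ab.1 * v.1 + ab.2 * v.2)%:~R) V0.
  exists ((ab.1 * v.1 + ab.2 * v.2) %/ 2)%Z; split; last by exists v => //; lia.
  by move=> v' /hv; rewrite ler_int; lia.
have [s sP] := int_range (2 * B).
pose f (ab : int * int) : R * R * R := ((ab.1%:~R, ab.2%:~R), (kf ab)%:~R + 1).
pose C := [seq f ab | ab <- allpairs pair s s & coprimez ab.1 ab.2].
have inC a b : `|a| <= 2 * B -> `|b| <= 2 * B -> coprimez a b -> f (a, b) \in C.
  move=> ha hb hab; apply/mapP; exists (a, b) => //; rewrite mem_filter hab.
  by apply/allpairsP; exists (a, b); rewrite !sP.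
have outC c : c \in C -> exists ab, coprimez ab.1 ab.2 /\ c = f ab.
  by move=> /mapP[ab]; rewrite mem_filter => /andP[h _] ->; exists ab.
have small z : feas C z -> forall a b k : int, (a != 0) || (b != 0) -> `|a| <= 2 * B -> `|b| <= 2 * B ->
    (forall v, v \in Vs -> 2 * k <= a * v.1 + b * v.2) ->
    k%:~R + 1 <= a%:~R * z.1 + b%:~R * z.2.
  move=> hz a b k hab ha hb.
  have [a' [b' [cab ha' hb' h]]] := fine_primitive (mem_in Vs) fst snd z hab.
  apply: h => k' hk'.
  have := hz _ (inC a' b' (le_trans ha' ha) (le_trans hb' hb) cab).
  rewrite /f /ev /=; apply: le_trans; rewrite lerD2r ler_int.
  have [_ [v vV hv]] := hkf (a', b'); have := hk' v vV; move: hv => /=; lia.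
have BR : (0 : R) < B%:~R by rewrite ltr0z.
have marg z : feas C z -> forall (n : R * R) v, v \in Vs ->
        (forall v', v' \in Vs -> ev n (toR R v) <= ev n (toR R v')) ->
        `|n.1| + `|n.2| <= 2 * B%:~R * (ev n z - ev n (toR R v) / 2).
  move=> hz; apply: (fine_margin hnc hB) => a b k hab ha hb.
  by apply: small => //; lia.
have feasE z : feas C z <-> fineV Vs z.
  split=> [hz a b k hab hk|hz c /outC[[a b] [hab ->]]]; last first.
    apply: hz (hkf (a, b)).1.
    apply/negPn; rewrite negb_or !negbK; apply/negP => /andP[/eqP a0 /eqP b0].
    by move: hab; rewrite a0 b0.
  have [hsm|hbg] : (`|a| <= 2 * B /\ `|b| <= 2 * B) \/ 2 * B <= `|a| + `|b|.
  - have := normr_ge0 a; have := normr_ge0 b; clear; lia.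
  - by apply: small => //; case: hsm.
  pose n : R * R := (a%:~R, b%:~R).
  have [v vV hv] := @seq_argmin R _ Vs (fun v => ev n (toR R v)) V0.
  have h2 := marg z hz n v vV hv.
  move: hbg; rewrite -(ler_int R) intrD intrM !intr_norm => h1.
  have h3 : 2 * B%:~R * 1 <= 2 * B%:~R * (ev n z - ev n (toR R v) / 2).
    by rewrite mulr1; apply: le_trans h1 h2.
  rewrite ler_pM2l in h3; last by lra.
  have := hk v vV; rewrite -(ler_int R) intrD !intrM; move: h3; rewrite /ev /n /toR /=; lra.
exists B => //; exists C; split.
- exact: feasE.
- move=> c /outC[[a b] [hab ->]]; exists a, b, (kf (a, b)); split=> //.
  exact: (hkf (a, b)).1.
- move=> [d1 d2] hd.
  have [d1n|d1p|d10] := ltgtP d1 0.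
  + by exists (f (1, 0)); [apply: inC => //; lia|rewrite /f /ev /=; lra].
  + by exists (f (-1, 0)); [apply: inC => //; lia|rewrite /f /ev /= intrN; lra].
  have [d2n|d2p|d20] := ltgtP d2 0.
  + by exists (f (0, 1)); [apply: inC => //; lia|rewrite /f /ev /=; lra].
  + by exists (f (0, -1)); [apply: inC => //; lia|rewrite /f /ev /= intrN; lra].
  by case: hd; rewrite d10 d20.
- by move=> z /feasE; exact: marg.
Qed.

Lemma fine_node_corner Vs C z0 w :
  (forall z, feas C z <-> fineV Vs z) ->
  (forall c, c \in C -> exists a b k : int,
        [/\ coprimez a b, forall v, v \in Vs -> 2 * k <= a * v.1 + b * v.2 &
            c = ((a%:~R, b%:~R), k%:~R + 1)]) ->
  (forall c, c \in C -> c.2 < ev c.1 z0) ->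
  node C w -> ~ integral w ->
  exists a b l1 l2 c, corner (mem_in Vs) fst snd w a b l1 l2 c.
Proof.
move=> feasE hC hz0 hw wI.
have [c1 [c2 [w1 [w2 [c1C c2C c12 [e1 e1' f1 n1] [e2 e2' f2 n2]]]]]] := node_edges hw hz0.
case/hC: c1C c12 e1 e1' => a1 [b1 [k1 [cop1 hk1 ->]]] /= c12 e1 e1'.
case/hC: c2C c12 e2 e2' => a2 [b2 [k2 [cop2 hk2 ->]]] /= c12 e2 e2'.
apply: (@corner_exists R _ (mem_in Vs) fst snd w w1 w2 a1 b1 k1 a2 b2 k2) => //; try exact/feasE.
- by move: c12; rewrite /cross /= -!intrM -intrB intr_eq0 (mulrC a2).
- by apply/feasE; case: hw.
Qed.

(* The point a is the lexicographic minimum of u and its perpendicular u1, and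
   u' = u + t u1 for a small t. *)
Lemma lex_argmin (A : seq (R * R)) u : A != [::] -> u <> (0, 0) ->
  exists a, [/\ a \in A, forall b, b \in A -> ev u a <= ev u b &
    exists u', forall b, b \in A -> b <> a -> ev u' a < ev u' b].
Proof.
move=> A0 u0; pose u1 : R * R := (- u.2, u.1).
have [m mA hm] := @seq_argmin R _ A (ev u) A0.
pose A' := [seq b <- A | ev u b == ev u m].
have A'0 : A' != [::].
  have : m \in A' by rewrite mem_filter eqxx.
  by case: (A').
have [a aA' ha] := @seq_argmin R _ A' (ev u1) A'0.
move: aA'; rewrite mem_filter => /andP[/eqP am aA].
have hu b : b \in A -> ev u a <= ev u b by rewrite am; exact: hm.
have strict b : b \in A -> b <> a -> ev u b = ev u a -> ev u1 a < ev u1 b.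
  move=> bA ba e; have /ha : b \in A' by rewrite mem_filter e am eqxx.
  rewrite le_eqVlt => /orP[/eqP e1|//]; case: ba.
  have nn : u.1 ^+ 2 + u.2 ^+ 2 != 0.
    rewrite paddr_eq0 ?sqr_ge0 // !sqrf_eq0; apply/negP => /andP[/eqP h1 /eqP h2].
    by apply: u0; rewrite [LHS]surjective_pairing h1 h2.
  rewrite [LHS]surjective_pairing [RHS]surjective_pairing; congr pair.
    apply: (mulfI nn).
    have h x : (u.1 ^+ 2 + u.2 ^+ 2) * x.1 = u.1 * ev u x - u.2 * ev u1 x.
      by rewrite /ev /u1 /=; ring.
    by rewrite !h e e1.
  apply: (mulfI nn).
  have h x : (u.1 ^+ 2 + u.2 ^+ 2) * x.2 = u.2 * ev u x + u.1 * ev u1 x.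
    by rewrite /ev /u1 /=; ring.
  by rewrite !h e e1.
exists a; split=> //.
pose C := [seq ((b.1 - a.1, b.2 - a.2), 0) : R * R * R | b <- A].
have evb b n : ev ((b.1 - a.1, b.2 - a.2) : R * R) n = ev n b - ev n a by rewrite /ev /=; ring.
have [||t t0 ht] := @feas_step R C u u1.
- by move=> c /mapP[b bA ->] /=; rewrite evb subr_ge0; exact: hu.
- move=> c /mapP[b bA ->] /=; rewrite !evb => /eqP; rewrite subr_eq0 => /eqP e.
  by rewrite subr_ge0; apply: ha; rewrite mem_filter e am eqxx.
exists (mv u (t / 2) u1) => b bA ba.
have evm x : ev (mv u (t / 2) u1) x = ev u x + t / 2 * ev u1 x by rewrite /ev /mv /=; ring.
have /ht : ((b.1 - a.1, b.2 - a.2), 0) \in C by apply/mapP; exists b.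
rewrite ev_mv /= !evb evm evm => h.
have := hu b bA; rewrite le_eqVlt => /orP[/eqP e|h2].
  have := strict b bA ba (esym e); rewrite e => h3.
  have : t / 2 * ev u1 a < t / 2 * ev u1 b by rewrite ltr_pM2l //; lra.
  lra.
have : 0 < ev u b - ev u a by lra.
move: h; set x := ev u b - _; set y := ev u1 b - _ => h hx.
suff : 0 < x + t / 2 * y by rewrite /x /y; lra.
lra.
Qed.
End FiniteRepresentation.

(** * Row vectors and pairs of coordinates *)

Section Coordinates.
Variable R : realType.
Implicit Types (x y v : 'rV[R]_2) (A P Q : set 'rV[R]_2) (z u : R * R).

Definition co x : R * R := (x 0 0, x 0 1).
Definition pt z : 'rV[R]_2 := \row_(j < 2) (if j == 0 then z.1 else z.2).

Lemma ptK : cancel pt co.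
Proof. by move=> [a b]; rewrite /co /pt !mxE. Qed.

Lemma coK : cancel co pt.
Proof.
move=> x; apply/rowP => j; rewrite !mxE /=; case: ifP => [/eqP -> //|].
by case: j => -[|[|//]] // h _; congr (x _ _); apply/val_inj.
Qed.

Lemma co_inj : injective co. Proof. exact: can_inj coK. Qed.

Definition cov u : 'cV[R]_2 := \col_(i < 2) (if i == 0 then u.1 else u.2).

Lemma real_pairingE x (u : 'cV[R]_2) : real_pairing x u = ev (u 0 0, u 1 0) (co x).
Proof.
rewrite /real_pairing !mxE !big_ord_recl big_ord0 addr0 /ev /co /=.
rewrite (_ : lift ord0 ord0 = 1 :> 'I_2); last exact/val_inj.
by rewrite mulrC [X in _ + X]mulrC.
Qed.

Lemma real_pairing_cov x u : real_pairing x (cov u) = ev u (co x).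
Proof. by rewrite real_pairingE !mxE /= -surjective_pairing. Qed.

Lemma pairingE x (n : 'cV[int]_2) : pairing x n = (n 0 0)%:~R * x 0 0 + (n 1 0)%:~R * x 0 1.
Proof. by rewrite /pairing real_pairingE !mxE. Qed.

Lemma latticeP x : lattice x <-> integral (co x).
Proof.
split=> [[n _ <-]|[i [j e]]].
  by exists (n 0 0), (n 0 1); rewrite /co !mxE.
exists (\row_(k < 2) if k == 0 then i else j) => //.
by apply: co_inj; rewrite e /co !mxE.
Qed.

Lemma convex_setP A : convex_set A <-> convex_pred (fun z => A (pt z)).
Proof.
have E (z z' : R * R) (l : {i01 R}) :
    pt (l%:num * z.1 + (1 - l%:num) * z'.1, l%:num * z.2 + (1 - l%:num) * z'.2) =
    conv l (pt z : convex_lmodType 'rV[R]_2) (pt z').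
  by apply/rowP => j; rewrite !mxE /=; case: ifP.
split=> [cA z z' l /andP[l0 l1] hz hz'|cA x y l].
  have := cA (pt z) (pt z') (Itv01 l0 l1); rewrite -E !inE => /(_ hz hz').
  by [].
rewrite !inE -[x]coK -[y]coK => hx hy; rewrite -E.
by apply: cA => //; rewrite ge0 le1.
Qed.

Lemma conv_hull_convex A : convex_pred (fun z => conv_hull A (pt z)).
Proof.
apply/convex_setP => x y l; rewrite !inE => hx hy B [cB AB].
by have := cB x y l; rewrite !inE; apply; [apply: hx|apply: hy].
Qed.

Lemma conv_hull_min A (K : R * R -> Prop) : convex_pred K ->
  (forall x, A x -> K (co x)) -> forall x, conv_hull A x -> K (co x).
Proof.
move=> cK hK x; apply: (smallest_sub (X := [set x | K (co x)])) => //.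
apply/convex_setP => z z' l hl; rewrite /= !ptK; exact: cK.
Qed.

Lemma conv_hull_gen A x : A x -> conv_hull A x.
Proof. exact: (@sub_gen_smallest _ _ A). Qed.

Lemma convex_gt u c : convex_pred (fun z => c < ev u z).
Proof.
move=> z z' l /andP[l0 l1] h1 h2.
have -> : ev u (l * z.1 + (1 - l) * z'.1, l * z.2 + (1 - l) * z'.2) =
    c + (l * (ev u z - c) + (1 - l) * (ev u z' - c)) by rewrite /ev /=; ring.
rewrite ltrDl; have [l00|l00] := eqVneq l 0; first by rewrite l00; lra.
by apply: ltr_wpDr; [apply: mulr_ge0; lra|apply: mulr_gt0; lra].
Qed.

(** If v were no generator, the functional exposing it would be strictly larger on all generators,
    hence on the whole hull, v included. *)
Lemma exposed_gen A v : is_vertex (conv_hull A) v -> A v.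
Proof.
move=> [u hu]; apply: contrapT => nA.
have vv : [set v] v by [].
have := vv; rewrite hu => -[hv hmin].
pose u' := (u 0 0, u 1 0); have eu x : real_pairing x u = ev u' (co x) := real_pairingE x u.
have hA x : A x -> ev u' (co v) < ev u' (co x).
  move=> Ax; have hx := conv_hull_gen Ax.
  rewrite ltNge; apply/negP => h; apply: nA.
  suff -> : v = x by [].
  suff : [set v] x by [].
  rewrite hu; split=> // y /hmin; rewrite !eu; exact: le_trans.
have cK : convex_pred (fun z => ev u' (co v) < ev u' z) by exact: convex_gt.
by have := conv_hull_min cK hA hv; rewrite ltxx.
Qed.

(** Balls of row vectors are boxes, as the norm is the maximum norm. *)
Lemma interiorP A x : interior A x <-> exists2 e : R, 0 < e &
  forall z, `|z.1 - x 0 0| < e -> `|z.2 - x 0 1| < e -> A (pt z).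
Proof.
split=> [/nbhs_ballP[e /= e0 h]|[e e0 h]].
  exists e => // z h1 h2; apply: h; split=> // i j; rewrite (ord1 i) /ball /= mxE distrC.
  have [->|j1] : j = 0 \/ j = 1 by case: j => -[|[|//]] hj; [left|right]; apply/val_inj.
    exact: h1.
  by rewrite j1; exact: h2.
apply/nbhs_ballP; exists e => // y [_ hy]; rewrite -[y]coK.
by apply: h; rewrite distrC; apply: hy.
Qed.

Lemma interior_below A x u : u <> (0, 0) -> interior A x ->
  exists2 y, A y & ev u (co y) < ev u (co x).
Proof.
move=> u0 /interiorP[e e0 he].
have n2 : 0 < u.1 ^+ 2 + u.2 ^+ 2.
  rewrite lt_neqAle addr_ge0 ?sqr_ge0 // andbT eq_sym paddr_eq0 ?sqr_ge0 //.
  rewrite !sqrf_eq0; apply/negP => /andP[/eqP h1 /eqP h2].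
  by apply: u0; rewrite [LHS]surjective_pairing h1 h2.
pose N : R := `|u.1| + `|u.2| + 1.
have N0 : 0 < N by rewrite /N ltr_wpDl ?addr_ge0.
pose d := e / N.
have d0 : 0 < d by apply: divr_gt0.
have dN (c : R) : `|c| < N -> `|d * c| < e.
  by move=> hc; rewrite normrM gtr0_norm // /d mulrAC ltr_pdivrMr // ltr_pM2l.
exists (pt ((co x).1 - d * u.1, (co x).2 - d * u.2)).
  apply: he => /=; rewrite addrAC subrr add0r normrN; apply: dN; rewrite /N.
    by have := normr_ge0 u.2; lra.
  by have := normr_ge0 u.1; lra.
by rewrite ptK; have := mulr_gt0 d0 n2; rewrite /ev /=; lra.
Qed.

Lemma collinear_dependent (p : 'I_3 -> 'rV[R]_2) u c : u <> (0, 0) ->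
  (forall i, ev u (co (p i)) = c) -> ~~ affinely_independent p.
Proof.
move=> u0 h; apply/negP; rewrite /affinely_independent row_free_unit => hM.
set M := (\matrix_(i < 2) _) in hM; apply: u0.
have e : M *m cov u = 0.
  apply/colP => i; rewrite [RHS]mxE.
  have -> : (M *m cov u) i 0 = real_pairing (p (lift ord0 i) - p ord0) (cov u).
    rewrite /real_pairing !mxE; apply: eq_bigr => k _; congr (_ * _).
    by rewrite /M !mxE.
  rewrite /real_pairing mulmxBl mxE [X in _ + X]mxE.
  by rewrite -!/(real_pairing _ _) !real_pairing_cov !h subrr.
have /colP ce : cov u = 0 by rewrite -(mulKmx hM (cov u)) e mulmx0.
have := ce 0; have := ce 1; rewrite !mxE /= => e2 e1.
by rewrite [LHS]surjective_pairing e1 e2.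
Qed.

Lemma dim2_points A : has_dim A 2 -> exists p : 'I_3 -> R * R,
  (forall i, A (pt (p i))) /\ forall u c, u <> (0, 0) -> exists i, ev u (p i) <> c.
Proof.
move=> [[p Ap hp] _]; exists (fun i => co (p i)); split=> [i|u c u0]; first by rewrite coK.
apply/existsNP => h; move: hp; apply/negP; exact: collinear_dependent u0 h.
Qed.

Lemma dim2_triangle A z0 z1 z2 : A (pt z0) -> A (pt z1) -> A (pt z2) ->
  (z1.1 - z0.1) * (z2.2 - z0.2) - (z1.2 - z0.2) * (z2.1 - z0.1) != 0 -> has_dim A 2.
Proof.
move=> A0 A1 A2 hD; split; last first.
  move=> p _; rewrite /affinely_independent /row_free neq_ltn.
  by rewrite (leq_ltn_trans (rank_leq_col _)).
exists (fun i => pt (nth z0 [:: z0; z1; z2] i)).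
  by case=> -[|[|[|//]]].
rewrite /affinely_independent; apply: inj_row_free => v /rowP hv.
have := hv 0; have := hv 1; rewrite !mxE !big_ord_recl !big_ord0 !addr0 !mxE /=.
rewrite (_ : lift ord0 ord0 = 1 :> 'I_2); last exact/val_inj.
set a := v 0 ord0; set b := v 0 1 => h2 h1.
have a0 : a = 0.
  apply: (mulIf hD); rewrite mul0r.
  have -> : a * ((z1.1 - z0.1) * (z2.2 - z0.2) - (z1.2 - z0.2) * (z2.1 - z0.1)) =
     (a * (z1.1 - z0.1) + b * (z2.1 - z0.1)) * (z2.2 - z0.2) -
     (a * (z1.2 - z0.2) + b * (z2.2 - z0.2)) * (z2.1 - z0.1) by ring.
  by rewrite h1 h2 !mul0r subrr.
have b0 : b = 0.
  apply: (mulIf hD); rewrite mul0r.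
  have -> : b * ((z1.1 - z0.1) * (z2.2 - z0.2) - (z1.2 - z0.2) * (z2.1 - z0.1)) =
     (a * (z1.2 - z0.2) + b * (z2.2 - z0.2)) * (z1.1 - z0.1) -
     (a * (z1.1 - z0.1) + b * (z2.1 - z0.1)) * (z1.2 - z0.2) by ring.
  by rewrite h1 h2 !mul0r subrr.
apply/rowP => j; rewrite mxE; case: j => -[|[|//]] hj.
  by rewrite -[RHS]a0 /a; congr (v _ _); apply/val_inj.
by rewrite -[RHS]b0 /b; congr (v _ _); apply/val_inj.
Qed.

Lemma dim1_points A : has_dim A 1 -> exists x y, [/\ A x, A y & x <> y].
Proof.
move=> [[p Ap hp] _]; exists (p 0), (p 1); split=> // e.
move: hp; rewrite /affinely_independent /row_free rank_rV.
suff -> : (\matrix_(i < 1) (p (lift ord0 i) - p ord0)) = 0 by rewrite eqxx.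
apply/matrixP => i j; rewrite !mxE (ord1 i) (_ : lift ord0 0 = 1 :> 'I_2); last exact/val_inj.
by rewrite -e subrr.
Qed.

Lemma dim1_segment A u c x y : u <> (0, 0) -> A x -> A y -> x <> y ->
  (forall x, A x -> ev u (co x) = c) -> has_dim A 1.
Proof.
move=> u0 Ax Ay xy hA; split.
  exists (fun i => if i == 0 then x else y); first by move=> i; case: ifP.
  rewrite /affinely_independent /row_free rank_rV eqb1.
  apply/eqP => /rowP e; apply: xy; apply/rowP => j.
  by have := e j; rewrite !mxE /= => /eqP; rewrite subr_eq0 => /eqP.
by move=> p Ap; apply: (collinear_dependent u0) => i; apply: hA.
Qed.
End Coordinates.

(** * Half-integral polygons *)

Lemma cV2_eq0 (n : 'cV[int]_2) : (n == 0) = (n 0 0 == 0) && (n 1 0 == 0).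
Proof.
apply/eqP/andP => [->|[/eqP n0 /eqP n1]]; first by rewrite !mxE.
apply/colP => i; rewrite mxE.
have [->|->] // : i = 0 \/ i = 1.
by case: i => -[|[|//]] hi; [left|right]; apply/val_inj.
Qed.

Lemma cV2_double (n : 'cV[int]_2) : n != 0 -> n *+ 2 != 0.
Proof. by rewrite !cV2_eq0 !mulmxnE !mulrn_eq0. Qed.

Section HalfIntegralPolygon.
Variable R : realType.
Implicit Types (x y : 'rV[R]_2) (A P : set 'rV[R]_2) (z u : R * R).

(* Vs lists the doubled coordinates of half-integral points of P. *)
Record half_vertices P (Vs : seq (int * int)) : Prop := HalfVertices {
  hv_noncollinear : noncollinear Vs;
  hv_mem : forall v, v \in Vs -> P (pt ((v.1%:~R : R) / 2, v.2%:~R / 2));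
  hv_min : forall u, u <> (0, 0) -> exists2 v, v \in Vs &
    forall x, P x -> ev u (toR R v) / 2 <= ev u (co x) }.

(** Only exposed generators are known to be half-integral, so the list keeps just these;
    [lex_argmin] shows that every functional still attains its minimum at one of them. Were they
    collinear, a nonzero functional constant on them would be constant on P, against dimension 2. *)
Lemma half_verticesP P : half_integral_polygon P -> exists Vs, half_vertices P Vs.
Proof.
move=> [[[A /finite_seqP[s eA] eP] hdim] hhalf].
have [p [Pp hp]] := dim2_points hdim.
have s0 : s != [::].
  apply/eqP => e; have := Pp 0; rewrite eP => /(_ set0); apply; split.
    by move=> x y l; rewrite inE.
  by rewrite eA e.
pose As := map (@co R) s.
have As0 : As != [::] by rewrite /As; case: (s) s0.
(* The floor serves to produce integers; on half-integral points it is exact. *)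
pose dbl x : int * int := (Num.floor (2 * x 0 0), Num.floor (2 * x 0 1)).
have dblE x : half_lattice x -> toR R (dbl x) = (2 * x 0 0, 2 * x 0 1).
  move=> /latticeP[i [j]]; rewrite /co !mxE => -[e1 e2].
  by rewrite /toR /dbl /= e1 e2 !intrKfloor.
pose Vs := [seq dbl a | a <- s & `[< is_vertex P a >]].
have VsP v : v \in Vs -> exists x, [/\ P x, half_lattice x & v = dbl x].
  move=> /mapP[a]; rewrite mem_filter => /andP[/asboolP ha _] ->; exists a; split=> //.
    have [u hu] := ha; have : [set a] a by [].
    by rewrite hu => -[].
  exact: hhalf.
have hmem v : v \in Vs -> P (pt ((v.1%:~R : R) / 2, v.2%:~R / 2)).
  move=> /VsP[x [Px hx ->]]; have := dblE x hx; rewrite /toR => -[-> ->].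
  suff -> : (2 * x 0 0 / 2, 2 * x 0 1 / 2) = co x by rewrite coK.
  by rewrite /co; congr pair; field.
have hmin u : u <> (0, 0) -> exists2 v, v \in Vs &
    forall x, P x -> ev u (toR R v) / 2 <= ev u (co x).
  move=> u0; have [a [aA ha [u' hu']]] := lex_argmin As0 u0.
  have memA x : A x -> co x \in As.
    by rewrite eA => xs; apply: map_f.
  have va : is_vertex P (pt a).
    exists (cov u'); apply/seteqP; split=> [x -> /=|x /= [Px hx]].
      split.
        rewrite eP; apply: conv_hull_gen; move: aA => /mapP[b bs ->].
        by rewrite coK eA.
      move=> y; rewrite !real_pairing_cov ptK eP.
      apply: (@conv_hull_min R A (fun z => ev u' a <= ev u' z)).
        by move=> z z' l; rewrite /ev /=; nra.
      move=> x' /memA hx'; have [->//|/eqP hne] := eqVneq (co x') a.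
      by apply: ltW; apply: hu'.
    apply: co_inj; rewrite ptK.
    have : ev u' a < ev u' (co x) \/ co x = a.
      move: Px; rewrite eP.
      apply: (@conv_hull_min R A (fun z => ev u' a < ev u' z \/ z = a)); last first.
        by move=> x' /memA hx'; have [->|/eqP hne] := eqVneq (co x') a; [right|left; apply: hu'].
      move=> z z' l /andP[l0 l1].
      have [->|l00] := eqVneq l 0.
        by rewrite !mul0r subr0 !mul1r !add0r -surjective_pairing.
      have [->|l11] := eqVneq l 1.
        by rewrite subrr !mul0r !mul1r !addr0 -surjective_pairing.
      have lp : 0 < l by rewrite lt_neqAle eq_sym l00.
      have lp1 : 0 < 1 - l by rewrite subr_gt0 lt_neqAle l11.
      have E (w w' : R * R) : ev u' (l * w.1 + (1 - l) * w'.1, l * w.2 + (1 - l) * w'.2) =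
          ev u' a + (l * (ev u' w - ev u' a) + (1 - l) * (ev u' w' - ev u' a)).
        by rewrite /ev /=; ring.
      move=> [h1|->] [h2|->].
      - left; rewrite E ltrDl; apply: addr_gt0; apply: mulr_gt0 => //; lra.
      - left; rewrite E ltrDl; apply: ltr_wpDr; last by apply: mulr_gt0 => //; lra.
        by rewrite subrr mulr0.
      - left; rewrite E ltrDl; apply: ltr_wpDl; last by apply: mulr_gt0 => //; lra.
        by rewrite subrr mulr0.
      - by right; rewrite [RHS]surjective_pairing; congr pair; ring.
    case=> // h; have Pa : P (pt a).
      by rewrite eP; apply: conv_hull_gen; move: aA => /mapP[b bs ->]; rewrite coK eA.
    by have := hx _ Pa; rewrite !real_pairing_cov ptK leNgt h.
  exists (dbl (pt a)).
    apply/mapP; exists (pt a) => //; rewrite mem_filter; apply/andP; split; first exact/asboolP.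
    by move: aA => /mapP[b bs ->]; rewrite coK.
  move=> x; rewrite dblE; last exact: hhalf.
  have -> : ev u (2 * pt a 0 0, 2 * pt a 0 1) / 2 = ev u a.
    by rewrite /ev /pt !mxE /=; field.
  rewrite eP; apply: (@conv_hull_min R A (fun z => ev u a <= ev u z)).
    by move=> z z' l; rewrite /ev /=; nra.
  by move=> x' /memA; apply: ha.
exists Vs; split=> //.
have [v0 v0V _] := hmin (1, 0) ltac:(by case=> /eqP; rewrite oner_eq0).
apply: contrapT => hn.
have [u u0 hu] : exists2 u, u <> (0, 0) & forall v, v \in Vs -> ev u (toR R v) = ev u (toR R v0).
  case: (pselect (exists2 v1, v1 \in Vs & v1 <> v0)) => [[v1 v1V v10]|h]; last first.
    exists (1, 0); first by case=> /eqP; rewrite oner_eq0.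
    by move=> v vV; have [->//|/eqP vv] := eqVneq v v0; case: h; exists v.
  exists (- (v1.2%:~R - v0.2%:~R), v1.1%:~R - v0.1%:~R).
    move=> [/eqP + /eqP]; rewrite oppr_eq0 !subr_eq0 !eqr_int => /eqP e2 /eqP e1; apply: v10.
    by rewrite [LHS]surjective_pairing [RHS]surjective_pairing e1 e2.
  move=> v vV; apply/eqP; rewrite -subr_eq0.
  have -> : ev (- (v1.2%:~R - v0.2%:~R), v1.1%:~R - v0.1%:~R) (toR R v) -
            ev (- (v1.2%:~R - v0.2%:~R), v1.1%:~R - v0.1%:~R) (toR R v0) =
     ((v1.1 - v0.1) * (v.2 - v0.2) - (v1.2 - v0.2) * (v.1 - v0.1))%:~R :> R.
    by rewrite !(intrM, intrB) /ev /toR /=; ring.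
  rewrite intr_eq0; apply/negPn/negP => h; apply: hn.
  by exists v0, v1, v.
have [i] := hp u (ev u (toR R v0) / 2) u0; apply.
have [v vV h1] := hmin u u0.
have [v' v'V h2] := hmin (- u.1, - u.2) ltac:(by move=> [/eqP + /eqP]; rewrite !oppr_eq0 => /eqP e1 /eqP e2; apply: u0; rewrite [LHS]surjective_pairing e1 e2).
have evN w : ev (- u.1, - u.2) w = - ev u w by rewrite /ev /=; ring.
have := h1 _ (Pp i); have := h2 _ (Pp i); rewrite !evN !ptK !hu //; lra.
Qed.

Variables (P : set 'rV[R]_2) (Vs : seq (int * int)).
Hypothesis hv : half_vertices P Vs.

Lemma hv_le u v v' : v \in Vs -> v' \in Vs ->
  (forall x, P x -> ev u (toR R v) / 2 <= ev u (co x)) ->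
  ev u (toR R v) <= ev u (toR R v').
Proof.
move=> vV v'V /(_ _ (hv_mem hv v'V)); rewrite ptK.
by rewrite (_ : ev u (v'.1%:~R / 2, v'.2%:~R / 2) = ev u (toR R v') / 2); [lra|rewrite /ev /toR /=; field].
Qed.

Lemma Min_min (n : 'cV[int]_2) : n != 0 ->
  let a := n 0 0 in let b := n 1 0 in
  (forall x, P x -> Min P n <= pairing x n) /\
  exists2 v, v \in Vs & 2 * Min P n = (a * v.1 + b * v.2)%:~R.
Proof.
move=> n0 a b; pose u : R * R := (a%:~R, b%:~R).
have u0 : u <> (0, 0).
  move=> [/eqP + /eqP]; rewrite !intr_eq0 => /eqP a0 /eqP b0.
  by move: n0; rewrite cV2_eq0 -/a -/b a0 b0.
have pE x : pairing x n = ev u (co x) by rewrite pairingE.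
have [v vV hmin] := hv_min hv u0.
pose values := (fun x => pairing x n) @` P.
have hV : (values `&` lbound values) (ev u (toR R v) / 2).
  split=> [|_ [x Px <-]]; last by rewrite pE; apply: hmin.
  exists (pt (v.1%:~R / 2, v.2%:~R / 2)); first exact: (hv_mem hv vV).
  by rewrite pE ptK /ev /toR /=; field.
have [M1 M2] : (values `&` lbound values) (Min P n) := xgetI 0 hV.
split=> [x Px|]; first by apply: M2; exists x.
exists v => //.
have -> : Min P n = ev u (toR R v) / 2.
  apply: le_anti; apply/andP; split; first by apply: M2; case: hV.
  by case: hV => _; apply.
by rewrite intrD !intrM /ev /toR /=; field.
Qed.

(** If [Min P n] is not an integer, it is at least k + 1/2 for each admissible k, and the condition
    on 2n says that the value of n at x is at least [Min P n] + 1/2, hence at least k + 1.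
    Conversely, [Fbar] uses the inequalities of n and of 2n with k equal to the respective minimum,
    which is an integer. *)
Lemma Fbar_fine x : Fbar P x <-> fineV Vs (co x).
Proof.
split=> [[h1 h2] a b k hab hk|hx].
  pose n : 'cV[int]_2 := \col_(i < 2) (if i == 0 then a else b).
  have n00 : n 0 0 = a by rewrite mxE.
  have n10 : n 1 0 = b by rewrite mxE.
  have n0 : n != 0.
    by rewrite cV2_eq0 n00 n10 negb_and.
  have [M1 [v vV M2]] := Min_min n0.
  have hkM : 2 * k%:~R <= 2 * Min P n.
    by rewrite M2 n00 n10; have := hk v vV; rewrite -(ler_int R) [(2 * k)%:~R]intrM.
  have pE : pairing x n = a%:~R * (co x).1 + b%:~R * (co x).2 by rewrite pairingE n00 n10.
  case: (boolP (Min P n \is a Num.int)) => hI.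
    by have := h1 n (conj n0 hI); rewrite pE; lra.
  have hM : 2 * Min P n >= (2 * k + 1)%:~R.
    rewrite M2 n00 n10 ler_int; have := hk v vV; rewrite le_eqVlt => /orP[/eqP e|]; last by lia.
    move: hI; rewrite (_ : Min P n = k%:~R) ?intr_int //.
    by have := M2; rewrite n00 n10 [X in X%:~R](esym e) intrM; lra.
  have nn0 : n *+ 2 != 0 := cV2_double n0.
  have [M3 [v' v'V M4]] := Min_min nn0.
  have hM2 : 2 * Min P n <= Min P (n *+ 2).
    have := M1 _ (hv_mem hv v'V); rewrite pairingE n00 n10 ![pt _ _ _]mxE /= => h.
    by move: M4; rewrite !mulmxnE n00 n10 !mulr2n !(intrD, intrM); lra.
  have := h2 n (conj n0 hI); have -> : pairing x (n *+ 2) = 2 * pairing x n.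
    by rewrite !pairingE !mulmxnE !mulr2n !intrD; ring.
  move: hM; rewrite pE intrD intrM; lra.
split=> n [n0 hI].
  have [M1 _] := Min_min n0; move/intrP: hI => [k hk].
  rewrite hk pairingE; apply: hx.
    by rewrite -negb_and -cV2_eq0.
  move=> v vV; have := M1 _ (hv_mem hv vV); rewrite hk pairingE !mxE /= => h.
  by rewrite -(ler_int R) intrD !intrM; lra.
have nn0 : n *+ 2 != 0 := cV2_double n0.
have [M1 [v vV M2]] := Min_min nn0.
have [k hk] : exists k : int, Min P (n *+ 2) = k%:~R.
  exists (n 0 0 * v.1 + n 1 0 * v.2).
  by move: M2; rewrite !mulmxnE !mulr2n !(intrD, intrM); lra.
rewrite hk pairingE; apply: hx.
  by rewrite -negb_and -cV2_eq0.
move=> v' v'V; have := M1 _ (hv_mem hv v'V); rewrite hk pairingE [pt _ _ _]mxE [pt _ _ _]mxE /= => h.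
by rewrite -(ler_int R) intrD !intrM; lra.
Qed.

(** At an interior point a functional exceeds its lower bound k strictly; at a lattice point its
    value is an integer, so it is at least k + 1. *)
Lemma interior_fine x : lattice x -> interior P x -> fineV Vs (co x).
Proof.
move=> /latticeP[i [j ex]] hx a b k hab hk.
pose u : R * R := (a%:~R, b%:~R).
have u0 : u <> (0, 0).
  by move=> [/eqP + /eqP]; rewrite !intr_eq0 => a0 b0; rewrite a0 b0 in hab.
have [y Py hy] := interior_below u0 hx.
have [v vV /(_ _ Py) hmin] := hv_min hv u0.
have hkv : (2 * k)%:~R <= ev u (toR R v).
  by have := hk v vV; rewrite -(ler_int R) [(a * _ + _)%:~R]intrD !intrM.
have h1 : (k%:~R : R) < (a * i + b * j)%:~R.
  have -> : (a * i + b * j)%:~R = ev u (co x) by rewrite ex intrD !intrM.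
  by move: hmin hkv hy; rewrite intrM; lra.
by have := intr_lt h1; rewrite -(ler_int R) !intrD !intrM ex; exact.
Qed.

(** A point z outside P in the box of radius 1/(2B) around x would be separated from P by some u.
    With |u| the l1-norm, the margin gives |u| <= 2B (u(x) - min u) < 2B (u(x) - u(z)) <= |u|. *)
Lemma fine_interior x : is_polytope P -> fineV Vs (co x) -> interior P x.
Proof.
move=> [A /finite_seqP[s eA] eP] hx.
have [B B0 [C [_ _ _ hdeep]]] := fine_finite R (hv_noncollinear hv).
have BR : (0 : R) < B%:~R by rewrite ltr0z.
apply/interiorP; exists (2 * B%:~R)^-1 => [|z hz1 hz2].
  by rewrite invr_gt0 mulr_gt0.
apply: contrapT => hn.
pose W := [seq ((a 0 0 - z.1, a 0 1 - z.2) : R * R) | a : 'rV[R]_2 <- s].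
case: (gordan W) => [[u hu]|h]; last first.
  apply: hn; have := h (fun w => P (pt (w.1 + z.1, w.2 + z.2))) _ _.
  rewrite /= !add0r -surjective_pairing; apply.
    move=> w w' l hl; rewrite eP => h1 h2.
    have := @conv_hull_convex R A _ _ l hl h1 h2; congr (conv_hull A (pt _)).
    by rewrite /=; congr pair; ring.
  move=> w /mapP[a as_ ->] /=; rewrite !subrK.
  by rewrite -[(_, _)]/(co a) coK eP; apply: conv_hull_gen; rewrite eA.
have hP y : P y -> ev u z < ev u (co y).
  rewrite eP; apply: (@conv_hull_min R A (fun w => ev u z < ev u w)).
    exact: convex_gt.
  rewrite eA => a /= as_.
  have /hu : (a 0 0 - z.1, a 0 1 - z.2) \in W by apply/mapP; exists a.
  by rewrite /ev /co /=; lra.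
have [v0 [_ [_ [v0V _ _ _]]]] := hv_noncollinear hv.
have u0 : u <> (0, 0).
  by move=> e; have := hP _ (hv_mem hv v0V); rewrite e /ev /= !mul0r addr0 ltxx.
have [v vV hmin] := hv_min hv u0.
have := hdeep _ hx u v vV (fun v' hv' => hv_le vV hv' hmin).
have := hP _ (hv_mem hv vV); rewrite ptK.
have -> : ev u (v.1%:~R / 2, v.2%:~R / 2) = ev u (toR R v) / 2 by rewrite /ev /toR /=; field.
move=> h1 h2.
have h3 : `|u.1| + `|u.2| < 2 * B%:~R * (ev u (co x) - ev u z).
  by apply: le_lt_trans h2 _; rewrite ltr_pM2l; lra.
have h4 : ev u (co x) - ev u z <= (`|u.1| + `|u.2|) * (2 * B%:~R)^-1.
  have -> : ev u (co x) - ev u z = u.1 * (x 0 0 - z.1) + u.2 * (x 0 1 - z.2).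
    by rewrite /ev /co /=; ring.
  rewrite mulrDl; apply: lerD; apply: le_trans (ler_norm _) _; rewrite normrM;
    by apply: ler_wpM2l => //; rewrite distrC ltW.
have : 2 * B%:~R * (ev u (co x) - ev u z) <= 2 * B%:~R * ((`|u.1| + `|u.2|) * (2 * B%:~R)^-1).
  by rewrite ler_pM2l //; lra.
rewrite mulrCA mulfV ?mulr1; last by rewrite gt_eqF //; lra.
by rewrite leNgt h3.
Qed.

(** This excludes the default value 0 of [num_lattice_points]. The functionals x, -x, y, -y bound
    P. *)
Lemma finite_lattice_points : finite_set (P `&` @lattice R).
Proof.
have [b hb] : exists b : int, forall x, P x -> `|x 0 0| <= b%:~R /\ `|x 0 1| <= b%:~R.
  have one u : u <> (0, 0) -> exists b : int, forall x, P x -> - b%:~R <= ev u (co x).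
    move=> /(hv_min hv)[v vV h]; exists (- Num.floor (ev u (toR R v) / 2)) => x /h.
    by apply: le_trans; rewrite intrN opprK floor_le.
  have [b1 h1] := one (1, 0) ltac:(by case=> /eqP; rewrite oner_eq0).
  have [b2 h2] := one (-1, 0) ltac:(by case=> /eqP; rewrite oppr_eq0 oner_eq0).
  have [b3 h3] := one (0, 1) ltac:(by case=> /eqP; rewrite oner_eq0).
  have [b4 h4] := one (0, -1) ltac:(by case=> /eqP; rewrite oppr_eq0 oner_eq0).
  exists (`|b1| + `|b2| + `|b3| + `|b4|) => x Px.
  have := h1 x Px; have := h2 x Px; have := h3 x Px; have := h4 x Px.
  rewrite /ev /co /= !intrD !intr_norm !mul0r !addr0 !add0r !mulN1r !mul1r.
  have := ler_norm (b1%:~R : R); have := ler_norm (b2%:~R : R).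
  have := ler_norm (b3%:~R : R); have := ler_norm (b4%:~R : R).
  have := normr_ge0 (b1%:~R : R); have := normr_ge0 (b2%:~R : R).
  have := normr_ge0 (b3%:~R : R); have := normr_ge0 (b4%:~R : R).
  by move=> *; rewrite !ler_norml; split; lra.
have [r hr] := int_range b.
have rP (i : int) : `|i%:~R : R| <= b%:~R -> i \in r.
  by rewrite -intr_norm ler_int; exact: hr.
apply: (@sub_finite_set _ _ ((fun p => pt (toR R p)) @` [set` allpairs pair r r])); last first.
  by apply: finite_image; apply/finite_seqP; eexists.
move=> x [/hb[h1 h2] /latticeP[i [j ex]]].
exists (i, j); last by rewrite /toR /= -ex coK.
move: h1 h2; rewrite -[x 0 0]/(co x).1 -[x 0 1]/(co x).2 ex /= => h1 h2.
exact: (@allpairs_f _ _ _ pair r r i j (rP i h1) (rP j h2)).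
Qed.

Lemma num_lattice_points_ge (S : seq (int * int)) : uniq S ->
  (forall s, s \in S -> P (pt (toR R s))) -> (size S <= num_lattice_points P)%N.
Proof.
move=> uS hS; rewrite -(size_map (fun s => pt (toR R s)) S).
apply: uniq_leq_size.
  rewrite map_inj_uniq // => -[a b] [a' b'] /(can_inj (@ptK R)) /= [/eqP + /eqP].
  by rewrite !eqr_int => /eqP -> /eqP ->.
move=> _ /mapP[s sS ->]; rewrite in_fset_set; last exact: finite_lattice_points.
by rewrite inE; split; [exact: hS|apply/latticeP; rewrite ptK; do 2 eexists].
Qed.

Lemma half_hull_mem z : is_polytope P -> half_hull (mem_in Vs) fst snd z -> P (pt z).
Proof.
move=> [A _ eP] h; apply: (h (fun z => P (pt z))); last exact: (hv_mem hv).
by rewrite eP; exact: conv_hull_convex.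
Qed.
End HalfIntegralPolygon.

(** * Cutting off the corners *)

Section Corners.
Variable R : realType.
Implicit Types (K : R * R -> Prop) (z w a b : R * R).

Lemma convex_triangle K w a b (s t : R) : convex_pred K -> K w -> K a -> K b ->
  0 <= s -> 0 <= t -> s + t <= 1 ->
  K (w.1 + s * (a.1 - w.1) + t * (b.1 - w.1), w.2 + s * (a.2 - w.2) + t * (b.2 - w.2)).
Proof.
move=> cK kw ka kb s0 t0 st.
have [e|e] := eqVneq (s + t) 0.
  have [-> ->] : s = 0 /\ t = 0 by lra.
  by rewrite !mul0r !addr0 -surjective_pairing.
have st0 : 0 < s + t by rewrite lt_neqAle eq_sym e; lra.
have hl : 0 <= s / (s + t) <= 1.
  by apply/andP; split; [apply: divr_ge0; lra|rewrite ler_pdivrMr //; lra].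
have hm : 0 <= s + t <= 1 by apply/andP; split; lra.
have := cK _ _ _ hm (cK _ _ _ hl ka kb) kw; congr K => /=.
by congr pair; field.
Qed.

Section Corner.
Variables (Vs : seq (int * int)) (w a b : R * R) (l1 l2 c : int).
Hypothesis hc : corner (mem_in Vs) fst snd w a b l1 l2 c.
Let l : R * R := (l1%:~R, l2%:~R).

Lemma corner_ne : a <> b.
Proof.
move=> e; have [f1 [f2]] := corner_primitive hc.
by rewrite e !subrr !mulr0 addr0 => /esym/eqP; rewrite oner_eq0.
Qed.

Lemma corner_l_ne : l <> (0, 0).
Proof.
move=> [e1 e2]; have := corner_lt hc; have := corner_eq_l hc.
by rewrite e1 e2 !mul0r addr0 => <-; rewrite ltxx.
Qed.

(** The functional l equals c at both a and b, so the position of a point relative to the cutting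
    line depends only on the sum of its two cone coordinates. *)
Lemma corner_split z : fineV Vs z -> exists x y : R, [/\ 0 <= x, 0 <= y,
  z = (w.1 + x * (a.1 - w.1) + y * (b.1 - w.1), w.2 + x * (a.2 - w.2) + y * (b.2 - w.2)) &
  ev l z - c%:~R = (1 - (x + y)) * (ev l w - c%:~R)].
Proof.
move=> /(corner_cone hc)[x [y [x0 y0 e1 e2]]]; exists x, y; split=> //.
  by rewrite [LHS]surjective_pairing e1 e2.
have ha := corner_eq_l hc; have hb := corner_eq_r hc.
have -> : ev l z = (1 - (x + y)) * ev l w + x * ev l a + y * ev l b.
  by rewrite /ev e1 e2; ring.
by rewrite /ev /l /= ha hb; ring.
Qed.

Lemma corner_below z : fineV Vs z -> ev l z <= c%:~R ->
  forall K, convex_pred K -> K w -> K a -> K b -> K z.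
Proof.
move=> /corner_split[x [y [x0 y0 -> hl]]] hz K cK kw ka kb.
apply: convex_triangle => //.
have h := corner_lt hc; rewrite -[_ + _ in X in X < _]/(ev l w) in h.
rewrite leNgt; apply/negP => xy.
have : 0 < (1 - (x + y)) * (ev l w - c%:~R) by rewrite nmulr_rgt0; lra.
by rewrite -hl; move: hz; lra.
Qed.

Lemma corner_on z : fineV Vs z -> ev l z = c%:~R -> exists t : R,
  0 <= t <= 1 /\ z = (t * a.1 + (1 - t) * b.1, t * a.2 + (1 - t) * b.2).
Proof.
move=> /corner_split[x [y [x0 y0 -> hl]]] hz; move: hl; rewrite hz subrr => /esym/eqP.
have h := corner_lt hc; rewrite -[_ + _ in X in X < _]/(ev l w) in h.
rewrite mulf_eq0 => /orP[/eqP e|/eqP e]; last by move: h; lra.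
exists x; split; first by apply/andP; split; lra.
have -> : y = 1 - x by lra.
by congr pair; ring.
Qed.

Lemma corner_cross : (a.1 - w.1) * (b.2 - w.2) - (a.2 - w.2) * (b.1 - w.1) != 0.
Proof.
apply/eqP => e; apply: corner_ne.
have ha := corner_eq_l hc; have hb := corner_eq_r hc; have h := corner_lt hc.
have n0 : c%:~R - ev l w != 0 by rewrite gt_eqF // subr_gt0.
have d1 : (c%:~R - ev l w) * (b.1 - a.1) = 0.
  transitivity (- l.2 * ((a.1 - w.1) * (b.2 - w.2) - (a.2 - w.2) * (b.1 - w.1)) +
     (b.1 - w.1) * (c%:~R - ev l a) - (a.1 - w.1) * (c%:~R - ev l b)).
    by rewrite /ev; ring.
  by rewrite e /ev /l /= ha hb; ring.
have d2 : (c%:~R - ev l w) * (b.2 - a.2) = 0.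
  transitivity (l.1 * ((a.1 - w.1) * (b.2 - w.2) - (a.2 - w.2) * (b.1 - w.1)) +
     (b.2 - w.2) * (c%:~R - ev l a) - (a.2 - w.2) * (c%:~R - ev l b)).
    by rewrite /ev; ring.
  by rewrite e /ev /l /= ha hb; ring.
move: d1 d2 => /eqP + /eqP; rewrite !mulf_eq0 (negPf n0) /= !subr_eq0 => /eqP e1 /eqP e2.
by rewrite [LHS]surjective_pairing [RHS]surjective_pairing e1 e2.
Qed.

(** An integral functional takes the value 1 on b - a; applied to the difference of the given
    lattice point and a, it shows that 1 - t is an integer. *)
Lemma corner_segment_integral (t : R) : 0 <= t <= 1 ->
  integral (t * a.1 + (1 - t) * b.1, t * a.2 + (1 - t) * b.2) -> t = 0 \/ t = 1.
Proof.
move=> /andP[t0 t1] [i [j [e1 e2]]].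
have [f1 [f2 hf]] := corner_primitive hc.
have [a1 [a2 ea]] := corner_integral_l hc.
have et : 1 - t = (f1 * (i - a1) + f2 * (j - a2))%:~R.
  rewrite !(intrD, intrM, intrN) -e1 -e2.
  move: hf; rewrite !ea /= => hf.
  transitivity ((1 - t) * (f1%:~R * (b.1 - a1%:~R) + f2%:~R * (b.2 - a2%:~R))).
    by rewrite hf mulr1.
  ring.
move: et; move: (f1 * _ + _) => m et.
have m0 : 0 <= m by rewrite -(ler0z R) -et; lra.
have m1 : m <= 1 by rewrite -(ler_int R) -et mulr1z; lra.
have [e|e] : m = 0 \/ m = 1 by lia.
  by right; move: et; rewrite e; lra.
by left; move: et; rewrite e; lra.
Qed.
End Corner.

Definition lattice_tight Vs z := [/\ fineV Vs z, integral z & tight (mem_in Vs) fst snd z].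

(* f w packs the data of the corner at w as ((a, b), ((l1, l2), c)). *)
Lemma truncated_hull Vs (C : seq (R * R * R)) (ws : seq (R * R))
    (f : R * R -> R * R * (R * R) * (int * int * int)) K :
  (forall z, feas C z <-> fineV Vs z) ->
  (forall c, c \in C -> exists a b k : int,
     [/\ coprimez a b, forall v, v \in Vs -> 2 * k <= a * v.1 + b * v.2 &
         c = ((a%:~R, b%:~R), k%:~R + 1)]) ->
  (forall d, d <> (0, 0) -> exists2 c, c \in C & ev c.1 d < 0) ->
  (forall z, node C z -> ~ integral z -> z \in ws) ->
  (forall w, w \in ws -> let d := f w in
     corner (mem_in Vs) fst snd w d.1.1 d.1.2 d.2.1.1 d.2.1.2 d.2.2) ->
  convex_pred K -> (forall z, lattice_tight Vs z -> K z) ->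
  forall z, fineV Vs z ->
    (forall w, w \in ws -> (f w).2.2%:~R <= ev ((f w).2.1.1%:~R, (f w).2.1.2%:~R) z) -> K z.
Proof.
move=> feasE hC hb hws hf cK hK.
pose g w : R * R * R := (((f w).2.1.1%:~R, (f w).2.1.2%:~R), (f w).2.2%:~R).
pose G := C ++ map g ws.
have feasG z : feas G z <-> fineV Vs z /\ forall w, w \in ws -> (g w).2 <= ev (g w).1 z.
  split=> [h|[h1 h2] c].
    split; first by apply/feasE => c cC; apply: h; rewrite mem_cat cC.
    by move=> w wW; apply: h; rewrite mem_cat orbC map_f.
  by rewrite mem_cat => /orP[/((feasE z).2 h1)//|/mapP[w wW ->]]; apply: h2.
suff H z : feas G z -> K z by move=> z h1 h2; apply: H; apply/feasG.
move: z; apply: (feas_hull cK).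
  by move=> d /hb[c cC cd]; exists c; rewrite // mem_cat cC.
have Ctight c z : c \in C -> ev c.1 z = c.2 -> tight (mem_in Vs) fst snd z.
  move=> /hC[a [b [k [cop hk ->]]]] /= e; exists a, b, k; split=> //.
  apply/negPn; rewrite negb_or !negbK; apply/negP => /andP[/eqP a0 /eqP b0].
  by move: cop; rewrite a0 b0.
have Gint z : fineV Vs z -> integral z -> feas G z.
  move=> hz iz; apply/feasG; split=> // w wW.
  exact: (corner_cut (hf w wW)).
(* A node of the truncated region on a cutting line is an end of the segment from a to b: at an
   inner point the second constraint, valid at a and b, would be tight at both and so parallel to
   the cut. *)
have extra c1 c2 z : feas G z -> c1 \in map g ws -> c2 \in G -> cross c1.1 c2.1 != 0 ->
    ev c1.1 z = c1.2 -> ev c2.1 z = c2.2 -> lattice_tight Vs z.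
  move=> hz /mapP[w wW ->] c2G h12 e1 e2.
  have hw := hf w wW; move: hw h12 e1; rewrite /g /=.
  move: (f w) => [[a b] [[l1 l2] c]] /= hw h12 e1.
  have [fz _] := (feasG z).1 hz.
  have [t [/andP[t0 t1] ez]] := corner_on hw fz e1.
  have Ka : lattice_tight Vs a.
    by split; [exact: corner_fine_l hw|exact: corner_integral_l hw|exact: corner_tight_l hw].
  have Kb : lattice_tight Vs b.
    by split; [exact: corner_fine_r hw|exact: corner_integral_r hw|exact: corner_tight_r hw].
  have [t00|t00] := eqVneq t 0.
    by move: ez; rewrite t00 !mul0r subr0 !mul1r !add0r -surjective_pairing => ->.
  have [t11|t11] := eqVneq t 1.
    by move: ez; rewrite t11 subrr !mul0r !mul1r !addr0 -surjective_pairing => ->.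
  have tp : 0 < t by rewrite lt_neqAle eq_sym t00.
  have tp1 : 0 < 1 - t by rewrite subr_gt0 lt_neqAle t11.
  have [fa ia _] := Ka; have [fb ib _] := Kb.
  have ha := Gint a fa ia _ c2G; have hb' := Gint b fb ib _ c2G.
  have ezz : ev c2.1 z = t * ev c2.1 a + (1 - t) * ev c2.1 b by rewrite ez /ev /=; ring.
  have eab : ev c2.1 a = ev c2.1 b.
    have h1 : 0 <= t * (ev c2.1 a - c2.2) by apply: mulr_ge0; lra.
    have h2 : 0 <= (1 - t) * (ev c2.1 b - c2.2) by apply: mulr_ge0; lra.
    have : t * (ev c2.1 a - c2.2) = 0 by lra.
    have : (1 - t) * (ev c2.1 b - c2.2) = 0 by lra.
    move=> /eqP + /eqP; rewrite !mulf_eq0 (gt_eqF tp) (gt_eqF tp1) /= !subr_eq0.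
    by move=> /eqP -> /eqP ->.
  have lab : ev (l1%:~R, l2%:~R) a = ev (l1%:~R, l2%:~R) b.
    by rewrite /ev /= (corner_eq_l hw) (corner_eq_r hw).
  case: (corner_ne hw).
  have d1 : cross (l1%:~R, l2%:~R) c2.1 * (a.1 - b.1) = 0.
    transitivity (c2.1.2 * (ev (l1%:~R, l2%:~R) a - ev (l1%:~R, l2%:~R) b) - l2%:~R * (ev c2.1 a - ev c2.1 b)).
      by rewrite /cross /ev /=; ring.
    by rewrite lab eab !subrr !mulr0 subrr.
  have d2 : cross (l1%:~R, l2%:~R) c2.1 * (a.2 - b.2) = 0.
    transitivity (- c2.1.1 * (ev (l1%:~R, l2%:~R) a - ev (l1%:~R, l2%:~R) b) + l1%:~R * (ev c2.1 a - ev c2.1 b)).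
      by rewrite /cross /ev /=; ring.
    by rewrite lab eab !subrr !mulr0 addr0.
  move: d1 d2 => /eqP + /eqP; rewrite !mulf_eq0 (negPf h12) /= !subr_eq0 => /eqP e3 /eqP e4.
  by rewrite [LHS]surjective_pairing [RHS]surjective_pairing e3 e4.
move=> z [hz [c1 [c2 [c1G c2G h12 e1 e2]]]]; apply: hK.
have crossC u d : cross u d = - cross d u :> R by rewrite /cross; ring.
case: (boolP (c1 \in map g ws)) => [c1w|c1w]; first exact: extra hz c1w c2G h12 e1 e2.
case: (boolP (c2 \in map g ws)) => [c2w|c2w].
  by apply: (extra c2 c1) => //; rewrite crossC oppr_eq0.
have c1C : c1 \in C by move: c1G; rewrite mem_cat (negPf c1w) orbF.
have c2C : c2 \in C by move: c2G; rewrite mem_cat (negPf c2w) orbF.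
have [fz hzw] := (feasG z).1 hz.
have nz : node C z by split; [exact/feasE|exists c1, c2].
case: (pselect (integral z)) => [iz|iz]; first by split=> //; exact: Ctight c1C e1.
(* A non-lattice node of the original region is strictly cut off by its own cutting line. *)
have zw := hws z nz iz; have := hzw z zw.
by have := corner_lt (hf z zw); rewrite /g /ev /= ltNge => /negP.
Qed.

Lemma node_seq (C : seq (R * R * R)) : exists ns : seq (R * R),
  forall z, z \in ns <-> node C z.
Proof.
pose sol (c d : R * R * R) : R * R :=
  ((c.2 * d.1.2 - d.2 * c.1.2) / cross c.1 d.1, (d.2 * c.1.1 - c.2 * d.1.1) / cross c.1 d.1).
exists [seq z <- allpairs sol C C | `[< node C z >]] => z; split.
  by rewrite mem_filter => /andP[/asboolP].
move=> nz; rewrite mem_filter; apply/andP; split; first exact/asboolP.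
case: nz => _ [c [d [cC dC hcd e1 e2]]].
apply/allpairsP; exists (c, d); split=> //=.
rewrite [LHS]surjective_pairing /sol -e1 -e2; move: hcd; rewrite /cross /ev => hcd.
by congr pair; field.
Qed.
End Corners.

(** * Boundary points and the assembly of the three statements *)

Lemma tight_not_interior (R : realType) (A : set 'rV[R]_2) Vs (x : 'rV[R]_2) :
  (forall y, A y -> fineV Vs (co y)) -> tight (mem_in Vs) fst snd (co x) -> ~ interior A x.
Proof.
move=> hA [a [b [k [hab hk e]]]] hx.
have u0 : (a%:~R, b%:~R) <> (0, 0) :> R * R.
  by move=> [/eqP + /eqP]; rewrite !intr_eq0 => a0 b0; rewrite a0 b0 in hab.
have [y /hA/(_ a b k hab hk) h1] := interior_below u0 hx.
by rewrite /ev /= e ltNge h1.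
Qed.

Theorem theorem3p9 (R : realType) (P0 : set 'rV[R]_2)
    (hP0 : half_integral_polygon P0) (hF : has_dim (Fbar P0) 2) :
  [/\ half_integral_polygon (Fbar P0) /\
      (forall e : set 'rV[R]_2,
         is_edge (Fbar P0) e -> e `&` @lattice R !=set0),
      (exists (m : nat) (e : 'I_m -> set 'rV[R]_2) (v : 'I_m -> 'rV[R]_2)
              (T : 'I_m -> set 'rV[R]_2),
         Fbar P0 = interior_hull P0 `|` \bigcup_(i in [set: 'I_m]) T i /\
         (forall i : 'I_m,
            [/\ is_triangle_over (e i) (v i) (T i),
                is_edge (interior_hull P0) (e i),
                num_lattice_points (e i) = 2%N &
                exists2 h : R, has_lattice_height (v i) (e i) h &
                  h <= 2^-1 * ((num_lattice_points P0)%:R + 2)])) &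
      (forall v : 'rV[R]_2, is_vertex (interior_hull P0) v ->
         lattice v /\ boundary (Fbar P0) v)].
Proof.
have [Vs hv] := half_verticesP hP0.
have polyP : is_polytope P0 by case: hP0 => -[].
have FE x := Fbar_fine hv x.
have [B B0 [C [feasE hC hb _]]] := fine_finite R (hv_noncollinear hv).
have [ns nsP] := node_seq C.
have [p [Fp hp]] := dim2_points hF.
have cF : convex_pred (fineV (R := R) Vs) by exact: fine_convex.
have Cne c : c \in C -> c.1 <> (0, 0).
  move=> /hC[a [b [k [cop _ ->]]]] /= [/eqP + /eqP]; rewrite !intr_eq0 => /eqP a0 /eqP b0.
  by move: cop; rewrite a0 b0.
(* The centroid of three non-collinear points of the region satisfies every constraint strictly. *)
have [z0 hz0] : exists z0 : R * R, forall c, c \in C -> c.2 < ev c.1 z0.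
  pose i0 : 'I_3 := 0; pose i1 : 'I_3 := 1; pose i2 : 'I_3 := 2%:R.
  exists (((p i0).1 + (p i1).1 + (p i2).1) / 3, ((p i0).2 + (p i1).2 + (p i2).2) / 3) => c cC.
  have hpc i : c.2 <= ev c.1 (p i).
    by have /FE := Fp i; rewrite ptK => /feasE; apply.
  have -> : ev c.1 (((p i0).1 + (p i1).1 + (p i2).1) / 3, ((p i0).2 + (p i1).2 + (p i2).2) / 3)
     = (ev c.1 (p i0) + ev c.1 (p i1) + ev c.1 (p i2)) / 3 by rewrite /ev /=; field.
  have h0 := hpc i0; have h1 := hpc i1; have h2 := hpc i2.
  rewrite ltr_pdivlMr // lt_neqAle; apply/andP; split; last by lra.
  apply/eqP => e; have [i] := hp c.1 c.2 (Cne c cC); apply.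
  have hi : [\/ i = i0, i = i1 | i = i2].
    by case: i => -[|[|[|//]]] hi; [constructor 1|constructor 2|constructor 3]; apply/val_inj.
  by case: hi => ->; lra.
have cornerE w : node C w -> ~ integral w -> exists d : R * R * (R * R) * (int * int * int),
    corner (mem_in Vs) fst snd w d.1.1 d.1.2 d.2.1.1 d.2.1.2 d.2.2.
  move=> nw iw; have [a [b [l1 [l2 [c hc]]]]] := fine_node_corner feasE hC hz0 nw iw.
  by exists ((a, b), ((l1, l2), c)).
have Fnode g : node C g -> fineV Vs g by move=> [/feasE].
have Fhull (K : R * R -> Prop) : convex_pred K -> (forall g, node C g -> K g) ->
    forall z, fineV Vs z -> K z.
  by move=> cK hK z /feasE; apply: feas_hull.
have Feq : Fbar P0 = conv_hull [set` map (@pt R) ns].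
  apply/seteqP; split=> x.
    move=> /FE hx; rewrite -[x]coK.
    apply: (Fhull (fun z => conv_hull _ (pt z))) => //; first exact: conv_hull_convex.
    by move=> g /nsP gn; apply: conv_hull_gen; rewrite /=; apply: map_f.
  move=> hx; apply/FE; apply: conv_hull_min hx => // y /= /mapP[g /nsP gn ->].
  by rewrite ptK; exact: Fnode.
have vertexN v : is_vertex (Fbar P0) v -> node C (co v).
  rewrite Feq => /exposed_gen /= /mapP[g /nsP gn ->].
  by rewrite ptK.
pose ws := [seq w <- ns | `[< ~ integral w >]].
have wsP w : w \in ws <-> node C w /\ ~ integral w.
  rewrite mem_filter; split=> [/andP[/asboolP iw /nsP]//|[nw iw]].
  by apply/andP; split; [exact/asboolP|exact/nsP].
have [f hf] : exists f : R * R -> R * R * (R * R) * (int * int * int), forall w, w \in ws ->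
    let d := f w in corner (mem_in Vs) fst snd w d.1.1 d.1.2 d.2.1.1 d.2.1.2 d.2.2.
  have /choice[f hf] : forall w, exists d : R * R * (R * R) * (int * int * int), w \in ws ->
      corner (mem_in Vs) fst snd w d.1.1 d.1.2 d.2.1.1 d.2.1.2 d.2.2.
    (* Outside [ws] an arbitrary value is returned. *)
    move=> w; case: (pselect (w \in ws)) => hw; last by exists ((w, w), ((0, 0), 0)).
    by have /wsP[nw iw] := hw; have [d hd] := cornerE w nw iw; exists d.
  by exists f.
pose Q := interior_hull P0.
have QL (K : R * R -> Prop) : convex_pred K -> (forall z, fineV Vs z -> integral z -> K z) ->
    forall x, Q x -> K (co x).
  move=> cK hK; apply: conv_hull_min => // x [hi hx].
  by apply: hK; [exact: interior_fine hv _ hx hi|exact/latticeP].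
have LQ z : fineV Vs z -> integral z -> Q (pt z).
  move=> fz iz; apply: conv_hull_gen; split; last by apply/latticeP; rewrite ptK.
  by apply: (fine_interior hv polyP); rewrite ptK.
have cQ : convex_pred (fun z => Q (pt z)) by exact: conv_hull_convex.
have QF x : Q x -> fineV Vs (co x) by apply: QL.
have trunc (K : R * R -> Prop) : convex_pred K -> (forall z, lattice_tight Vs z -> K z) ->
  forall z, fineV Vs z ->
    (forall w, w \in ws -> (f w).2.2%:~R <= ev ((f w).2.1.1%:~R, (f w).2.1.2%:~R) z) -> K z.
  have hws z : node C z -> ~ integral z -> z \in ws by move=> ng ig; exact/wsP.
  exact: (truncated_hull feasE hC hb hws hf).
(* Vertices of a hull are among its generators; with tight generators only, every vertex of Q lies
   on the boundary of the region. *)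
have Qtight : Q = conv_hull [set x | lattice_tight Vs (co x)].
  apply/seteqP; split=> x.
    move=> hx; rewrite -[x]coK; apply: (QL (fun z => conv_hull _ (pt z))) hx.
      exact: conv_hull_convex.
    move=> z fz iz; apply: (trunc (fun z => conv_hull _ (pt z))) => //.
    - exact: conv_hull_convex.
    - by move=> y hy; apply: conv_hull_gen; rewrite /= ptK.
    - by move=> w wW; apply: (corner_cut (hf w wW)).
  move=> hx; rewrite -[x]coK; apply: (conv_hull_min cQ) hx => y [fy iy _].
  exact: LQ.
split; first split.
- split; first split.
  + by exists [set` map (@pt R) ns] => //; apply/finite_seqP; eexists.
  + exact: hF.
  + move=> v /vertexN nv; case: (pselect (integral (co v))) => [[i [j e]]|iv].
      apply/latticeP; exists (2 * i), (2 * j); rewrite /co !mxE !intrM.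
      by rewrite -[v 0 0]/(co v).1 -[v 0 1]/(co v).2 e.
    have [d hd] := cornerE _ nv iv; have [i [j [e1 e2]]] := corner_half hd.
    by apply/latticeP; exists i, j; rewrite /co !mxE -e1 -e2.
- move=> e [[u eE] /dim1_points[x [y [ex ey xy]]]].
  pose u' := (u 0 0, u 1 0); have eu x' : real_pairing x' u = ev u' (co x') := real_pairingE x' u.
  have [Fx hx] : Fbar P0 x /\ forall y, Fbar P0 y -> ev u' (co x) <= ev u' (co y).
    by move: ex; rewrite eE /= => -[? h]; split=> // y' /h; rewrite !eu.
  have inE z : fineV Vs z -> ev u' z <= ev u' (co x) -> e (pt z).
    move=> fz hz; rewrite eE /=; split; first by apply/FE; rewrite ptK.
    by move=> y' Fy'; rewrite !eu ptK; apply: le_trans hz (hx _ Fy').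
  have outE x' : e x' -> fineV Vs (co x') /\ ev u' (co x') = ev u' (co x).
    rewrite eE /= => -[/FE fx' h]; split=> //; apply: le_anti.
    by rewrite -!eu h //= !eu hx //; apply/FE.
  have ns0 : ns != [::].
    apply/eqP => n0; have := Fhull (fun=> False) _ _ _ ((FE x).1 Fx); apply=> // g /nsP.
    by rewrite n0.
  (* A node g minimising the functional lies on the edge. If g is not integral, write another point
     of the edge in cone coordinates at g: a nonzero coordinate puts the lattice point a or b on the
     edge. *)
  have [g /nsP gn hg] := seq_argmin (ev u') ns0.
  have ug : ev u' g <= ev u' (co x).
    apply: (Fhull (fun z => ev u' g <= ev u' z)); last exact/FE.
      by move=> z z' l hl; rewrite /ev /=; nra.
    by move=> g' /nsP; exact: hg.
  have eg := inE g (Fnode g gn) ug.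
  case: (pselect (integral g)) => ig.
    by exists (pt g); split=> //; apply/latticeP; rewrite ptK.
  have [d hd] := cornerE g gn ig; move: d hd => [[a b] [[l1 l2] c]] /= hd.
  have gx : ev u' g = ev u' (co x) by have [_] := outE _ eg; rewrite ptK.
  have ua : ev u' g <= ev u' a.
    by rewrite gx; have := hx (pt a); rewrite ptK; apply; apply/FE; rewrite ptK; exact: corner_fine_l hd.
  have ub : ev u' g <= ev u' b.
    by rewrite gx; have := hx (pt b); rewrite ptK; apply; apply/FE; rewrite ptK; exact: corner_fine_r hd.
  have [x' ex' xg] : exists2 x', e x' & co x' <> g.
    case: (pselect (co x = g)) => [h|h]; last by exists x.
    by exists y => // h'; apply: xy; apply: co_inj; rewrite h h'.
  have [fx' ux'] := outE x' ex'.
  have [s [t [s0 t0 est _]]] := corner_split hd fx'.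
  have key : s * (ev u' a - ev u' g) + t * (ev u' b - ev u' g) = 0.
    have : ev u' (co x') = ev u' g + s * (ev u' a - ev u' g) + t * (ev u' b - ev u' g).
      by rewrite est /ev /=; ring.
    rewrite ux' gx; lra.
  have k1 : 0 <= s * (ev u' a - ev u' g) by apply: mulr_ge0 => //; lra.
  have k2 : 0 <= t * (ev u' b - ev u' g) by apply: mulr_ge0 => //; lra.
  have [s00|s00] := eqVneq s 0.
    have [t00|t00] := eqVneq t 0.
      by case: xg; rewrite est s00 t00 !mul0r !addr0 -surjective_pairing.
    have : t * (ev u' b - ev u' g) == 0 by apply/eqP; lra.
    rewrite mulf_eq0 (negPf t00) /= subr_eq0 => /eqP ebg.
    exists (pt b); split; last by apply/latticeP; rewrite ptK; exact: corner_integral_r hd.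
    by apply: inE; [exact: corner_fine_r hd|rewrite ebg gx].
  have : s * (ev u' a - ev u' g) == 0 by apply/eqP; lra.
  rewrite mulf_eq0 (negPf s00) /= subr_eq0 => /eqP eag.
  exists (pt a); split; last by apply/latticeP; rewrite ptK; exact: corner_integral_l hd.
  by apply: inE; [exact: corner_fine_l hd|rewrite eag gx].
- pose w (i : 'I_(size ws)) := nth (0, 0) ws i.
  have wW i : w i \in ws by apply: mem_nth.
  pose E i := conv_hull [set pt (f (w i)).1.1; pt (f (w i)).1.2].
  pose Tr i := conv_hull (E i `|` [set pt (w i)]).
  have TrF i x : Tr i x -> Fbar P0 x.
    have h := hf _ (wW i); move=> hx; apply/FE; apply: (conv_hull_min cF) hx => y [hy|->].
      apply: (conv_hull_min cF) hy => y' [->|->]; rewrite ptK.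
        exact: corner_fine_l h.
      exact: corner_fine_r h.
    by rewrite ptK; apply: Fnode; have /wsP[] := wW i.
  exists (size ws), E, (fun i => pt (w i)), Tr; split.
    apply/seteqP; split=> [x /FE fx|x [/QF /FE //|[i _ /TrF]//]].
    case: (pselect (exists2 w', w' \in ws & ev ((f w').2.1.1%:~R, (f w').2.1.2%:~R) (co x) < (f w').2.2%:~R)).
      move=> [w' w'W hx]; right; pose i := Ordinal (eq_ind _ is_true w'W _ (esym (index_mem w' ws))).
      have wi : w i = w' by rewrite /w /= nth_index.
      exists i => //; rewrite -[x]coK.
      have h := hf _ (wW i); rewrite -wi in hx.
      apply: (corner_below h fx (ltW hx) (K := fun z => Tr i (pt z))).
      + exact: conv_hull_convex.
      + by apply: conv_hull_gen; right.
      + by apply: conv_hull_gen; left; apply: conv_hull_gen; left.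
      + by apply: conv_hull_gen; left; apply: conv_hull_gen; right.
    move=> hn; left; rewrite -[x]coK; apply: (trunc (fun z => Q (pt z))) => //.
      by move=> z [fz iz _]; exact: LQ.
    by move=> w' w'W; rewrite leNgt; apply/negP => h; apply: hn; exists w'.
  move=> i; have := hf _ (wW i); rewrite /E /Tr /E.
  move: (f (w i)) => [[a b] [[l1 l2] c]] /= h.
  set e := conv_hull [set pt a; pt b].
  have ea : e (pt a) by apply: conv_hull_gen; left.
  have eb : e (pt b) by apply: conv_hull_gen; right.
  pose l : R * R := (l1%:~R, l2%:~R).
  have la : ev l a = c%:~R := corner_eq_l h.
  have lb : ev l b = c%:~R := corner_eq_r h.
  have lw : ev l (w i) < c%:~R := corner_lt h.
  have eF x : e x -> fineV Vs (co x).
    apply: conv_hull_min => // y [->|->]; rewrite ptK.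
      exact: corner_fine_l h.
    exact: corner_fine_r h.
  have eQ x : e x -> Q x.
    move=> hx; rewrite -[x]coK; apply: (conv_hull_min cQ) hx => y [->|->]; rewrite ptK.
      by apply: LQ; [exact: corner_fine_l h|exact: corner_integral_l h].
    by apply: LQ; [exact: corner_fine_r h|exact: corner_integral_r h].
  have el x : e x -> ev l (co x) = c%:~R.
    apply: (@conv_hull_min R _ (fun z => ev l z = c%:~R)).
      move=> z z' r _ hz hz'.
      have -> : ev l (r * z.1 + (1 - r) * z'.1, r * z.2 + (1 - r) * z'.2) = r * ev l z + (1 - r) * ev l z'.
        by rewrite /ev /=; ring.
      by rewrite hz hz'; ring.
    by move=> y [->|->]; rewrite ptK.
  have abne : pt a <> pt b by move=> /(can_inj (@ptK R)); exact: corner_ne h.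
  split.
  + split=> //; apply: (@dim2_triangle R _ (w i) a b).
    * by apply: conv_hull_gen; right.
    * by apply: conv_hull_gen; left.
    * by apply: conv_hull_gen; left.
    * exact: corner_cross h.
  (* The functional l is at least c on Q and exposes the base. If Q is only a segment, l is constant
     on it and the face is Q itself, so the degenerate case is included. *)
  + split; last exact: (dim1_segment (corner_l_ne h) ea eb abne el).
    have lQ x : Q x -> c%:~R <= ev l (co x).
      apply: (QL (fun z => c%:~R <= ev l z)); first by move=> z z' r hr; rewrite /ev /=; nra.
      by move=> z fz iz; exact: (corner_cut h fz iz).
    exists (cov l); apply/seteqP; split=> x /=.
      move=> ex; split; first exact: eQ.
      by move=> y /lQ; rewrite !real_pairing_cov (el x ex).
    move=> [Qx hx]; have := hx _ (eQ _ ea); rewrite !real_pairing_cov ptK la => hxl.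
    have hxc : ev l (co x) = c%:~R by apply: le_anti; rewrite hxl lQ.
    have [t [ht ex]] := corner_on h (QF x Qx) hxc.
    rewrite -[x]coK ex; apply: (@conv_hull_convex R [set pt a; pt b] a b t ht) => //.
  + have -> : num_lattice_points e = #|` fset_set [set pt a; pt b]|.
      rewrite /num_lattice_points; congr (#|` fset_set _|); apply/seteqP; split=> x.
        move=> [ex /latticeP hx]; have [t [ht ext]] := corner_on h (eF x ex) (el x ex).
        rewrite ext in hx; have [e0|e1] := corner_segment_integral h ht hx.
          right; apply: co_inj; rewrite ptK ext e0 !mul0r subr0 !mul1r !add0r.
          by rewrite -surjective_pairing.
        left; apply: co_inj; rewrite ptK ext e1 subrr !mul0r !mul1r !addr0.
        by rewrite -surjective_pairing.
      by move=> [->|->]; split=> //; apply/latticeP; rewrite ptK;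
        [exact: corner_integral_l h|exact: corner_integral_r h].
    rewrite fset_setU ?fset_set1; [|exact: finite_set1|exact: finite_set1].
    by rewrite cardfs2; case: eqP abne.
  + exists (c%:~R - ev l (w i)).
      exists (\col_(k < 2) (if k == 0 then l1 else l2)), c%:~R; split.
      * by rewrite /primitive !mxE; exact: corner_coprime h.
      * by move=> x /el; rewrite pairingE !mxE.
      * by rewrite pairingE !mxE /= distrC gtr0_norm // subr_gt0.
    have [S [uS hS memS]] := corner_points h.
    have := num_lattice_points_ge hv uS _.
    have hm : forall s, s \in S -> P0 (pt (toR R s)).
      by move=> s sS; apply: (half_hull_mem hv polyP); exact: memS.
    move=> /(_ hm); rewrite -(ler_nat R); move: hS; rewrite /ev /l /=; lra.
- move=> v hvx; split.
    by have [_ ?] := exposed_gen hvx.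
  have hvx' : is_vertex Q v by [].
  rewrite Qtight in hvx'; have [fv iv tv] := exposed_gen hvx'.
  split; first by apply: subset_closure; apply/FE.
  by apply: (tight_not_interior (Vs := Vs)) => // y /FE.
Qed.
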